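(* Let $W(D_8)$ be the Weyl group of type $D_8$ with generating set $S=\{(i,i+1):1\le i<8\}\cup\{\overline{(1,2)}\}$, acting on the set $\Omega_{240}$ of packings of $PG(3,2)$ by signed permutations as described in the context, and let $\mathrm{ht}$ be the height statistic on packings. (i) The set $\Omega_{240}$ is a transitive quasiparabolic $W(D_8)$-set, with minimal element $x_0$ and height function $\lambda(x)=\mathrm{ht}(x)$. (ii) For each of the following parabolic subgroups $W_I=\langle I\rangle\le W(D_8)$, the set $\Omega_{240}$ is a transitive quasiparabolic $W_I$-set with minimal element $x_0$ and height function $\lambda(x)=\mathrm{ht}(x)$, and the quasiparabolic order in each case agrees with the Bruhat order on packings $(\Omega_{240},\le)$: (a) $S_8\cong W(A_7)$, generated by $I=S\setminus\{\overline{(1,2)}\}$; (b) $W(D_5)$, generated by $I=S\setminus\{(5,6),(6,7),(7,8)\}$; (c) any standard parabolic subgroup $W_I$ satisfying $W(D_5)\le W_I\le W(D_8)$, including $W(D_6)$, generated by $I=S\setminus\{(6,7),(7,8)\}$, and $W(D_7)$, generated by $I=S\setminus\{(7,8)\}$.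
   Context: Write $\mathbf{8}=\{1,\dots,8\}$. An $\mathbf{8}$-labelled Fano plane is a set of seven $3$-element subsets (''triples'') of $\mathbf{8}$ that are the lines of a Fano plane $PG(2,2)$ on seven of the eight labels; the unused label is its basepoint. There are $240$ of these; they index and are identified with the packings of $PG(3,2)$ (partitions of the $35$ lines into seven spreads, a spread being a partition of the $15$ points into five lines). Their set is $\Omega_{240}$. $S_8$ acts on it by permuting labels. Let $x_0=\{127,136,145,235,246,347,567\}$, where $ijk=\{i,j,k\}$. Signed permutation action. Let $V=\mathbb{F}_2^8/U$, where $\mathbb{F}_2^8$ has basis $\varepsilon_1,\dots,\varepsilon_8$ and $U$ is spanned by the all-ones vector. For $A\subseteq\mathbf{8}$ let $v_A$ be the coset of $\sum_{i\in A}\varepsilon_i$; let $\Lambda^-$ be the set of all $v_A$ with $|A|$ odd. For $x\in\Omega_{240}$ with basepoint $l$, $\lambda^-(x)\subset\Lambda^-$ is the set consisting of $v_A$ for the seven triples $A$ of $x$ together with $v_{\{l\}}$; $\lambda^-$ is injective. $W(D_8)$ is the group of signed permutations of $8$ objects involving evenly many sign changes; $\overline{(i,j)}$ exchanges objects $i$ and $j$ and changes the sign of each. $W(D_8)$ acts on $\Lambda^-$: unsigned permutations permute coordinates ($\varepsilon_k\mapsto\varepsilon_{w(k)}$) and changing the sign of object $i$ acts as adding $\varepsilon_i$. This induces the action on $\Omega_{240}$ given by $\lambda^-(wx)=w\lambda^-(x)$. Height and Bruhat order. For $x\in\Omega_{240}$, $\mathrm{ht}(x)=\min\{\ell(w):w\in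 S_8,\ wx_0=x\}$, where $\ell$ is the length in $S_8$ with respect to simple transpositions. For a transposition $t\in S_8$ write $x\prec tx$ if $\mathrm{ht}(x)<\mathrm{ht}(tx)$; the Bruhat order $(\Omega_{240},\le)$ is the reflexive, transitive closure of $\prec$. Quasiparabolic sets (Rains--Vazirani). Let $W$ be a Weyl group with generating set $S$ of simple reflections and set $T$ of reflections (conjugates of elements of $S$). For $W(D_8)$, $T=\{(i,j)\}\cup\{\overline{(i,j)}\}$, $1\le i<j\le 8$; for a parabolic subgroup $W_I$ the generating set is $I$. A scaled $W$-set is a pair $(X,\lambda)$ with $X$ a $W$-set and $\lambda:X\to\mathbb{Z}$ satisfying $|\lambda(sx)-\lambda(x)|\le1$ for all $s\in S$, $x\in X$; $\lambda(x)$ is called the height of $x$. An element $x$ is minimal if $\lambda(sx)\ge\lambda(x)$ for all $s\in S$. A quasiparabolic $W$-set is a scaled $W$-set such that (QP1) for any $r\in T$, $x\in X$, if $\lambda(rx)=\lambda(x)$ then $rx=x$; and (QP2) for any $r\in T$, $x\in X$, $s\in S$, if $\lambda(rx)>\lambda(x)$ and $\lambda(srx)<\lambda(sx)$ then $rx=sx$. The quasiparabolic order on $X$ is the smallest partial order such that $x\le_Q rx$ whenever $x\in X$, $r\in T$ and $\lambda(x)\le\lambda(rx)$. Transitive means that $W$ acts transitively on $X$. *)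

(* Defs.v *)
From mathcomp Require Import all_boot all_order all_algebra all_fingroup.

Set Implicit Arguments.
Unset Strict Implicit.
Unset Printing Implicit Defensive.

Import Order.TTheory GRing.Theory Num.Theory.
Local Open Scope ring_scope.

(* Labels are 'I_8, so the label written k in 1..8 is [lab k], of value k - 1. *)
Definition lab (k : nat) : 'I_8 := inord k.-1.

(* Over F_2 a point of PG(2,2) is its unique nonzero vector, and the line
   joining distinct points u and v is {u, v, u + v}. *)
Definition pg22_lines : {set {set 'rV['F_2]_3}} :=
  [set l | [exists u, exists v,
     [&& u != 0, v != 0, u != v & l == [set u; v; u + v]]]].

(* The value of f at the zero vector, which is not a point, is irrelevant. *)
Definition labelled_fano (x : {set {set 'I_8}}) : bool :=
  [exists f : {ffun 'rV['F_2]_3 -> 'I_8},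
    dinjectiveb f [pred u | u != 0]
    && (x == [set f @: (l : {set 'rV['F_2]_3}) | l in pg22_lines])].

Definition Omega240 : finType := {x : {set {set 'I_8}} | labelled_fano x}.

Definition triple (i j k : nat) : {set 'I_8} := [set lab i; lab j; lab k].

Definition x0_triples : {set {set 'I_8}} :=
  [set triple 1 2 7; triple 1 3 6; triple 1 4 5; triple 2 3 5;
       triple 2 4 6; triple 3 4 7; triple 5 6 7].

Lemma x0_fano : labelled_fano x0_triples.
Proof.
pose num (u : 'rV['F_2]_3) : nat :=
  ((u 0%R ord0 != 0%R :> 'F_2) + (u 0%R (inord 1) != 0%R :> 'F_2) * 2
   + (u 0%R (inord 2) != 0%R :> 'F_2) * 4)%N.
pose tab n := (nth 8 [:: 8; 1; 2; 7; 3; 6; 5; 4] n)%N.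
pose vec (b : bool * bool * bool) : 'rV['F_2]_3 :=
  \row_j (nth false [:: b.1.1; b.1.2; b.2] j)%:R.
have numE b : num (vec b) = (b.1.1 + b.1.2 * 2 + b.2 * 4)%N.
  by rewrite /num !mxE !inordK //=; case: b => [[[] []] []].
have vecK u : exists b, u = vec b.
  exists (u 0 ord0 != 0, u 0 (inord 1) != 0, u 0 (inord 2) != 0).
  have e (a : 'F_2) : (a != 0)%:R = a by case: a => [[|[|]]] //= h; apply/val_inj.
  apply/rowP => j; rewrite mxE; case: j => [[|[|[|]]]] //= h; rewrite e;
    by congr (fun_of_matrix u _ _); apply/val_inj; rewrite /= ?inordK.
have vec0 b : (vec b != 0) = (b != (false, false, false)).
  apply/idP/idP; apply: contraNN => /eqP e.
    by rewrite e; apply/eqP/rowP => j; rewrite !mxE; case: j => [[|[|[|]]]].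
  have := numE b; have -> : num (vec b) = 0%N by rewrite e /num !mxE.
  by case: b {e} => [[[] []] []].
have vecD b c : vec b + vec c
    = vec (b.1.1 (+) c.1.1, b.1.2 (+) c.1.2, b.2 (+) c.2).
  apply/rowP => j; rewrite !mxE; case: j => [[|[|[|]]]] //= h;
  by case: b => [[[] []] []]; case: c => [[[] []] []]; apply/val_inj.
have lab_inj m n : (0 < m <= 8)%N -> (0 < n <= 8)%N -> lab m = lab n -> m = n.
  case: m n => [|m] [|n] //= m8 n8 /(congr1 val).
  by rewrite /= !inordK //= => ->.
pose f : {ffun 'rV['F_2]_3 -> 'I_8} := [ffun u => lab (tab (num u))].
have fE b : f (vec b) = lab (tab (b.1.1 + b.1.2 * 2 + b.2 * 4)%N).
  by rewrite ffunE numE.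
apply/existsP; exists f; apply/andP; split.
  apply/dinjectiveP => u v _ _; have [b ->] := vecK u; have [c ->] := vecK v.
  rewrite !fE => /lab_inj e; congr vec; move: e.
  by case: b => [[[] []] []]; case: c => [[[] []] []] => // /(_ isT isT).
have lineE b c : f @: [set vec b; vec c; vec b + vec c]
    = [set f (vec b); f (vec c); f (vec b + vec c)].
  by rewrite !imsetU !imset_set1.
have mem_line b c : b != (false, false, false) -> c != (false, false, false) ->
    b != c -> [set f (vec b); f (vec c); f (vec b + vec c)]
    \in [set f @: (l : {set 'rV['F_2]_3}) | l in pg22_lines].
  move=> b0 c0 bc; rewrite -lineE; apply: imset_f; rewrite inE.
  apply/existsP; exists (vec b); apply/existsP; exists (vec c).
  rewrite !vec0 b0 c0 eqxx andbT /=; apply: contraNneq bc => e.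
  have := numE b; rewrite e numE.
  by case: b {b0 e} => [[[] []] []]; case: c {c0} => [[[] []] []].
rewrite eqEsubset; apply/andP; split; apply/subsetP => A.
  pose v n := (odd n, odd n./2, odd n./2./2).
  have mem m n : v m != v 0%N -> v n != v 0%N -> v m != v n ->
      A = [set f (vec (v m)); f (vec (v n)); f (vec (v m) + vec (v n))] ->
      A \in [set f @: (l : {set 'rV['F_2]_3}) | l in pg22_lines].
    by move=> m0 n0 mn ->; apply: mem_line.
  rewrite !inE -!orbA => /or4P[||| /or4P[]] /eqP e.
  - by apply: (mem 1%N 2%N) => //; rewrite e vecD !fE.
  - by apply: (mem 1%N 4%N) => //; rewrite e vecD !fE /triple setUAC.
  - by apply: (mem 1%N 7%N) => //; rewrite e vecD !fE.
  - by apply: (mem 2%N 4%N) => //; rewrite e vecD !fE.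
  - by apply: (mem 2%N 7%N) => //; rewrite e vecD !fE.
  - by apply: (mem 4%N 7%N) => //; rewrite e vecD !fE.
  - by apply: (mem 6%N 5%N) => //; rewrite e vecD !fE.
case/imsetP => l; rewrite inE => /existsP[u /existsP[w]].
have [b ->] := vecK u; have [c ->] := vecK w.
case/and4P; rewrite !vec0 => b0 c0 bc /eqP-> ->.
have {}bc : b != c by apply: contraNneq bc => ->.
rewrite lineE vecD !fE.
have tripleC i j k : triple i j k \in x0_triples ->
    triple j i k \in x0_triples /\ triple i k j \in x0_triples.
  have -> : triple j i k = triple i j k.
    by rewrite /triple (setUC [set lab j]).
  have -> : triple i k j = triple i j k.
    by rewrite /triple setUAC.
  by [].
have tripleP i j k : triple i j k \in x0_triples ->
    [/\ triple j i k \in x0_triples, triple i k j \in x0_triples,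
        triple j k i \in x0_triples, triple k i j \in x0_triples
      & triple k j i \in x0_triples].
  move=> x1; have [x2 x3] := tripleC _ _ _ x1.
  have [_ x4] := tripleC _ _ _ x2; have [x5 _] := tripleC _ _ _ x3.
  by have [x6 _] := tripleC _ _ _ x4.
have t127 : triple 1 2 7 \in x0_triples by rewrite !inE eqxx ?orbT.
have [? ? ? ? ?] := tripleP _ _ _ t127.
have t136 : triple 1 3 6 \in x0_triples by rewrite !inE eqxx ?orbT.
have [? ? ? ? ?] := tripleP _ _ _ t136.
have t145 : triple 1 4 5 \in x0_triples by rewrite !inE eqxx ?orbT.
have [? ? ? ? ?] := tripleP _ _ _ t145.
have t235 : triple 2 3 5 \in x0_triples by rewrite !inE eqxx ?orbT.
have [? ? ? ? ?] := tripleP _ _ _ t235.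
have t246 : triple 2 4 6 \in x0_triples by rewrite !inE eqxx ?orbT.
have [? ? ? ? ?] := tripleP _ _ _ t246.
have t347 : triple 3 4 7 \in x0_triples by rewrite !inE eqxx ?orbT.
have [? ? ? ? ?] := tripleP _ _ _ t347.
have t567 : triple 5 6 7 \in x0_triples by rewrite !inE eqxx ?orbT.
have [? ? ? ? ?] := tripleP _ _ _ t567.
by case: b b0 bc => [[[] []] []] // _; case: c c0 => [[[] []] []].
Qed.

Definition x0 : Omega240 := exist _ x0_triples x0_fano.

Definition relabel (s : {perm 'I_8}) (x : {set {set 'I_8}}) : {set {set 'I_8}} :=
  [set s @: (A : {set 'I_8}) | A in x].

(* Word length with respect to S; [S ^+ n] is the set of products of n elements
   of S.  Elements of <<S>> have length less than #|gT|, so the default value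
   #|gT| is only reached outside <<S>>. *)
Definition word_length (gT : finGroupType) (S : {set gT}) (w : gT) : nat :=
  \big[minn/#|gT|]_(n < #|gT| | w \in (S ^+ n)%g) n.

Definition simple_transpositions : {set {perm 'I_8}} :=
  [set tperm (lab i.+1) (lab i.+2) | i : 'I_7].

(* The default value exceeds every length and the index set is never empty,
   S_8 being transitive on the labelled Fano planes. *)
Definition ht (x : Omega240) : nat :=
  \big[minn/#|{perm 'I_8}|]_(w : {perm 'I_8} | relabel w (val x0) == val x)
     word_length simple_transpositions w.

Definition bruhat_prec : rel Omega240 := fun x y =>
  [exists i : 'I_8, exists j : 'I_8,
     [&& i != j, val y == relabel (tperm i j) (val x) & (ht x < ht y)%N]].

Definition bruhat_le : rel Omega240 := connect bruhat_prec.

(* The signed objects are pairs (k, b), standing for k if b = false and for -k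
   if b = true; a signed permutation is a permutation commuting with negation. *)
Definition signed_obj : finType := ('I_8 * bool)%type.

Definition is_signed (w : {perm signed_obj}) : bool :=
  [forall k : 'I_8, forall b : bool,
     w (k, ~~ b) == ((w (k, b)).1, ~~ (w (k, b)).2)].

Definition sign_changes (w : {perm signed_obj}) : {set 'I_8} :=
  [set k | (w (k, false)).2].

(* W(D_n), acting on the objects 1, ..., n and fixing the others. *)
Definition WD (n : nat) : {set {perm signed_obj}} :=
  [set w | [&& is_signed w, ~~ odd #|sign_changes w|
             & [forall k : 'I_8, (n <= k)%N ==> (w (k, false) == (k, false))]]].

Definition unsigned_S8 : {set {perm signed_obj}} :=
  [set w | is_signed w && (sign_changes w == set0)].

Definition swap (i j : nat) : {perm signed_obj} :=
  (tperm (lab i, false) (lab j, false) * tperm (lab i, true) (lab j, true))%g.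

Definition swap_bar (i j : nat) : {perm signed_obj} :=
  (tperm (lab i, false) (lab j, true) * tperm (lab i, true) (lab j, false))%g.

Definition S_D8 : {set {perm signed_obj}} :=
  swap_bar 1 2 |: [set swap i.+1 i.+2 | i : 'I_7].

Definition eps (k : 'I_8) : 'rV['F_2]_8 := delta_mx 0 k.

(* Elements of V = F_2^8 / U are represented as cosets of U. *)
Definition U : {vspace 'rV['F_2]_8} := <[const_mx 1]>%VS.

Definition vcoset (A : {set 'I_8}) : {set 'rV['F_2]_8} :=
  [set \sum_(i in A) eps i + u | u in U].

Definition lambda_minus (x : Omega240) : {set {set 'rV['F_2]_8}} :=
  [set vcoset A | A in val x] :|: [set vcoset [set l] | l in ~: cover (val x)].

(* eps_k is moved to eps_|w(k)|, and eps_|w(k)| is added whenever w changes the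
   sign of the object k. *)
Definition signed_vect (w : {perm signed_obj}) (a : 'rV['F_2]_8) : 'rV['F_2]_8 :=
  \sum_k a 0 k *: eps (w (k, false)).1
  + \sum_(k in sign_changes w) eps (w (k, false)).1.

Definition signed_image (w : {perm signed_obj}) (L : {set {set 'rV['F_2]_8}}) :
    {set {set 'rV['F_2]_8}} :=
  [set signed_vect w @: (C : {set 'rV['F_2]_8}) | C in L].

(* For w in W(D_8), the unique y with lambda_minus y = w (lambda_minus x); the
   default value x is only relevant outside W(D_8). *)
Definition signed_act (w : {perm signed_obj}) (x : Omega240) : Omega240 :=
  odflt x [pick y | lambda_minus y == signed_image w (lambda_minus x)].

Section Quasiparabolic.

Variables (gT : finGroupType) (X : Type).
Variables (W S : {set gT}) (act : gT -> X -> X) (height : X -> int).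

(* Products of permutations are composed from left to right in MathComp, hence
   the order of the factors in a left W-set. *)
Definition is_Wset : Prop :=
  (forall x, act 1%g x = x)
  /\ {in W &, forall v w, forall x, act (v * w)%g x = act w (act v x)}.

Definition is_transitive : Prop :=
  forall x y, exists2 w, w \in W & act w x = y.

Definition reflections : {set gT} := class_support S W.

Definition is_scaled : Prop :=
  is_Wset /\ {in S, forall s x, `|height (act s x) - height x| <= 1}.

Definition is_minimal (x : X) : Prop :=
  {in S, forall s, height x <= height (act s x)}.

Definition QP1 : Prop :=
  {in reflections, forall r x, height (act r x) = height x -> act r x = x}.

Definition QP2 : Prop :=
  {in reflections & S, forall r s x,
     height x < height (act r x) -> height (act s (act r x)) < height (act s x) ->
     act r x = act s x}.

Definition is_quasiparabolic : Prop := [/\ is_scaled, QP1 & QP2].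

Definition is_partial_order (R : X -> X -> Prop) : Prop :=
  [/\ forall x, R x x,
      forall x y, R x y -> R y x -> x = y
    & forall x y z, R x y -> R y z -> R x z].

Definition increases_under_reflections (R : X -> X -> Prop) : Prop :=
  {in reflections, forall r x, height x <= height (act r x) -> R x (act r x)}.

(* R is the quasiparabolic order, i.e. the smallest such partial order. *)
Definition is_quasiparabolic_order (R : X -> X -> Prop) : Prop :=
  [/\ is_partial_order R,
      increases_under_reflections R
    & forall R', is_partial_order R' -> increases_under_reflections R' ->
      forall x y, R x y -> R' x y].

Definition is_transitive_quasiparabolic (x : X) : Prop :=
  [/\ <<S>>%g = W, is_quasiparabolic, is_transitive & is_minimal x].

End Quasiparabolic.

Definition packings_quasiparabolic (W S : {set {perm signed_obj}}) : Prop :=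
  is_transitive_quasiparabolic W S signed_act (fun x => (ht x)%:Z) x0.

Definition quasiparabolic_order_is_bruhat (W S : {set {perm signed_obj}}) : Prop :=
  is_quasiparabolic_order W S signed_act (fun x => (ht x)%:Z)
    (fun x y => bruhat_le x y).

(* Main.v *)
Require Import Defs.
From mathcomp Require Import all_boot all_order all_algebra all_fingroup.
From mathcomp Require Import zify.

(** There are only 240 packings, and the proof rests on a small amount of
    verified data about them. The image lambda^-(x) consists of eight elements
    of Lambda^-, that is of eight sets of labels up to complement; the set of
    these eight is the code of x. Simple reflections act on codes by an explicit
    rule (lemma signed_image_code), every packing is a relabelling of x0 (lemma
    fano_relabel), and a breadth-first search from x0 lists all codes together
    with the number of simple transpositions needed to reach them, which is
    shown to be ht (lemma htE).

    The axioms QP1 and QP2 for W(D_8) mention a reflection r only through the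
    pair (x, r x). The relation formed by all these pairs is contained in any
    relation that contains the pairs (x, s x), s simple, and is invariant under
    the simple reflections. Such a relation, with 14 neighbours for each packing,
    is tabulated, and both axioms are checked for all pairs of neighbours (lemma
    packings_D8). They pass to parabolic subgroups because these have fewer
    generators and fewer reflections.

    The comparison of the orders needs no further enumeration of reflections. In
    a quasiparabolic W-set let J be a set of simple reflections such that every
    element of positive height is lowered by some element of J. If y = r x
    covers x, meaning that its height is one more, a descent s of y in J either
    carries x to y or lowers both x and y; by induction y = r' x for a
    reflection r' of the subgroup generated by J (lemma covers_sub). Moreover
    the lifting property shows that any reflection raising the height is a chain
    of covers (lemma reflection_chain). Thus W and any parabolic subgroup
    containing J define the same quasiparabolic order. By inspection of the
    table, every packing other than x0 has a descent among the generators of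
    S_8, and also among those of W(D_5). The quasiparabolic order for S_8 is the
    Bruhat order, since the transpositions are the reflections of S_8; hence so
    is the order for each parabolic subgroup containing W(D_5). Descents also
    give transitivity, since they lead from any packing to x0.

    A set I of simple reflections generates a group containing W(D_5) only if it
    contains the five simple reflections of W(D_5), since each of them violates
    an invariant of all the others (lemma D5_gens_necessary). *)

Set Implicit Arguments.
Unset Strict Implicit.
Unset Printing Implicit Defensive.

Import Order.TTheory GRing.Theory Num.Theory.

(** * Quasiparabolic orders of parabolic subgroups *)

Section Reflections.

Variables (gT : finGroupType).
Implicit Types (I K : {set gT}) (r s : gT).

Lemma gen_reflection I s : s \in I -> s \in reflections <<I>>%g I.
Proof. by move=> sI; apply/imset2P; exists s 1%g; rewrite ?group1 // conjg1. Qed.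

Lemma reflectionJ I r s :
  s \in I -> r \in reflections <<I>>%g I -> (r ^ s)%g \in reflections <<I>>%g I.
Proof.
move=> sI /imset2P[t w tI wW ->]; apply/imset2P.
by exists t (w * s)%g; rewrite ?conjgM // groupM // mem_gen.
Qed.

Lemma reflection_in_gen I r : r \in reflections <<I>>%g I -> r \in <<I>>%g.
Proof. by case/imset2P=> t w tI wW ->; rewrite groupJ // mem_gen. Qed.

Lemma sub_reflections I K :
  I \subset K -> reflections <<I>>%g I \subset reflections <<K>>%g K.
Proof. by move=> IK; apply: imset2S => //; apply: genS. Qed.

(** As the group is finite, its elements are products of generators without
    inverses, so that conjugating by one generator at a time is enough. *)
Lemma reflection_ind I (P : gT -> Prop) :
  {in I, forall s, P s} ->
  {in reflections <<I>>%g I & I, forall r s, P r -> P (r ^ s)%g} ->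
  {in reflections <<I>>%g I, forall r, P r}.
Proof.
move=> Pgen PJ r /imset2P[t w tI /gen_prodgP[n [c cI ->]] ->].
elim: n c cI => [|n IHn] c cI; first by rewrite big_ord0 conjg1; apply: Pgen.
rewrite big_ord_recr conjgM; apply: PJ => //; last exact: IHn.
apply/imset2P; exists t (\prod_(i < n) c (widen_ord (leqnSn n) i))%g => //.
by apply: group_prod => i _; rewrite mem_gen.
Qed.

Lemma sub_quasiparabolic (X : Type) I K (act : gT -> X -> X) height :
  I \subset K -> is_quasiparabolic <<K>>%g K act height ->
  is_quasiparabolic <<I>>%g I act height.
Proof.
move=> IK [[[act1 actM] lip] qp1 qp2].
have /subsetP gIK := genS IK; have /subsetP rIK := sub_reflections IK.
move/subsetP: IK => IK; split.
- by do 2?split=> //; [move=> v w /gIK vK /gIK | move=> s /IK]; auto.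
- by move=> r /rIK; apply: qp1.
- by move=> r s /rIK rK /IK; apply: qp2.
Qed.

End Reflections.

(** In this section J is a set of generators among which every element of
    positive height has a descent. This alone forces the partial orders that
    increase under the reflections of <<J>> to increase under all reflections:
    covers, that is reflections raising the height by 1, can be realized in
    <<J>>, and every reflection raising the height is a chain of covers. *)
Section ParabolicOrder.

Variables (gT : finGroupType) (X : Type) (S J : {set gT}).
Variables (act : gT -> X -> X) (h : X -> nat).

Let height x := Posz (h x).

Hypothesis qpX : is_quasiparabolic <<S>>%g S act height.
Hypothesis invS : {in S, forall s, (s * s = 1)%g}.
Hypothesis sJS : J \subset S.
Hypothesis descentJ : forall x, 0 < h x -> exists2 s, s \in J & h (act s x) < h x.

Let T := reflections <<S>>%g S.
Let TJ := reflections <<J>>%g J.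

Lemma act_involution s x : s \in S -> act s (act s x) = x.
Proof.
move=> sS; case: qpX => [[[act1 actM] _] _ _].
by rewrite -actM ?mem_gen // invS // act1.
Qed.

(** The conjugate r ^ s acts on s x as r acts on x, transported by s. *)
Lemma act_reflectionJ r s x :
  r \in T -> s \in S -> act (r ^ s)%g (act s x) = act s (act r x).
Proof.
move=> /reflection_in_gen rW sS; case: (qpX) => [[[_ actM] _] _ _].
have sW := mem_gen sS.
by rewrite -!actM ?groupJ // -conjgC.
Qed.

Lemma height_step s x : s \in S ->
  (h (act s x) <= (h x).+1) && (h x <= (h (act s x)).+1).
Proof.
by move=> sS; case: (qpX) => [[_ /(_ s sS x) lip] _ _]; move: lip;
  rewrite ler_norml /height; lia.
Qed.

Lemma reflection_height_eq r x : r \in T -> h (act r x) = h x -> act r x = x.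
Proof.
by move=> rT hrx; case: qpX => [_ qp1 _]; apply: qp1; rewrite // /height hrx.
Qed.

Lemma reflection_exchange r s x : r \in T -> s \in S ->
  h x < h (act r x) -> h (act s (act r x)) < h (act s x) -> act r x = act s x.
Proof. by move=> rT sS hr hs; case: qpX => [_ _ qp2]; apply: qp2. Qed.

Definition covers x y := exists2 r, r \in T & y = act r x /\ h y = (h x).+1.

Inductive cover_chain x : X -> Prop :=
| ChainNil : cover_chain x x
| ChainCons y z : cover_chain x y -> covers y z -> cover_chain x z.

Lemma cover_chain_trans x y z : cover_chain x y -> cover_chain y z -> cover_chain x z.
Proof. by move=> xy; elim=> // ? ? _; apply: ChainCons. Qed.

Lemma cover_chain1 x y : covers x y -> cover_chain x y.
Proof. by apply: ChainCons; constructor. Qed.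

Lemma gen_covers s x : s \in S -> h x < h (act s x) -> covers x (act s x).
Proof.
move=> sS hx; exists s; first exact: gen_reflection.
by split=> //; have := height_step x sS; lia.
Qed.

(** A descent s of y either sends y to x or lowers x as well. In the latter case
    s y covers s x, by induction through a reflection of <<J>>, whose conjugate
    by s sends x to y. *)
Lemma covers_sub x y : covers x y -> exists2 r, r \in TJ & y = act r x.
Proof.
have [n] := ubnP (h y); elim: n x y => // n IHn x y le_hy [r rT [yE hy]].
have [|s sJ hsy] := descentJ (x := y); first by rewrite hy.
have sS := subsetP sJS s sJ.
have sx := height_step x sS; have sy := height_step y sS.
have rsT : (r ^ s)%g \in T by apply: reflectionJ.
have rsx : act (r ^ s)%g (act s x) = act s y by rewrite act_reflectionJ // -yE.
have [hsx | hsx | hsx] := ltngtP (h (act s x)) (h x).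
- have [||r' r'T e] := IHn (act s x) (act s y); first by lia.
    by exists (r ^ s)%g => //; split; [rewrite rsx | lia].
  exists (r' ^ s)%g; first exact: reflectionJ.
  have r'S : r' \in T by move: r' r'T {e}; apply/subsetP/sub_reflections.
  by rewrite -(act_involution y sS) e -act_reflectionJ // act_involution.
- exists s; first exact: gen_reflection.
  by rewrite yE; apply: reflection_exchange => //; rewrite -yE; lia.
have e : act s y = act s x by rewrite -rsx; apply: reflection_height_eq;
  rewrite // rsx; lia.
by have := act_involution y sS; rewrite e act_involution // => xy; move: hy;
  rewrite xy; lia.
Qed.

(** The larger of x and s x. *)
Definition raise s x := if h x < h (act s x) then act s x else x.

Lemma chain_raise s x : s \in S -> cover_chain x (raise s x).
Proof.
rewrite /raise => sS; case: ifP => [hx | _]; last by constructor.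
exact/cover_chain1/gen_covers.
Qed.

(** One half of the lifting property of Bruhat orders. Let z cover y. If s raises
    both, it carries the cover to a cover. If s raises y but not z, then either
    s z is lower than s y, and QP2 says that z = s y, or they have the same
    height, and QP1 yields s z = s y, which is absurd. *)
Lemma cover_chain_raise s x y :
  s \in S -> cover_chain x y -> cover_chain (raise s x) (raise s y).
Proof.
move=> sS; elim=> [|{}y z _ IH yz]; first by constructor.
apply: cover_chain_trans IH _; rewrite {1}/raise; case: ifP => hy; last first.
  by apply: cover_chain_trans (chain_raise _ sS); apply: cover_chain1.
case: yz => r rT [zE hz]; rewrite /raise.
have sy := height_step y sS; have sz := height_step z sS.
have rsT : (r ^ s)%g \in T by apply: reflectionJ.
have rsy : act (r ^ s)%g (act s y) = act s z by rewrite act_reflectionJ // -zE.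
case: ifP => hsz.
  by apply: cover_chain1; exists (r ^ s)%g => //; split; [rewrite rsy | lia].
have [lt_sz | ge_sz] := ltnP (h (act s z)) (h (act s y)).
  rewrite zE (@reflection_exchange r s y) -?zE //; [constructor | lia].
have e : act s z = act s y by rewrite -rsy; apply: reflection_height_eq;
  rewrite // rsy; lia.
have := act_involution z sS; rewrite e act_involution // => yz; move: hz;
  rewrite yz; lia.
Qed.

(** Induction on the height of y = r x along a descent s of y. If s raises or
    fixes x, the pair (s x, s y) is closer than (x, y). If s lowers x, a chain
    from s x to s y is lifted by s to one from x to y. *)
Lemma reflection_chain r x : r \in T -> h x < h (act r x) -> cover_chain x (act r x).
Proof.
have [n] := ubnP (h (act r x)); elim: n r x => // n IHn r x le_hy rT hxy.
set y := act r x in le_hy hxy *.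
have [|s sJ hsy] := descentJ (x := y); first by lia.
have sS := subsetP sJS s sJ.
have sx := height_step x sS; have sy := height_step y sS.
have rsT : (r ^ s)%g \in T by apply: reflectionJ.
have rsx : act (r ^ s)%g (act s x) = act s y by rewrite act_reflectionJ.
have syy : cover_chain (act s y) y.
  have := @gen_covers s (act s y) sS; rewrite act_involution // => cov.
  exact/cover_chain1/cov.
have [eq_xy | neq_xy] := eqVneq (h y) (h x).+1.
  by apply: cover_chain1; exists r.
have IHs : h (act s x) < h (act s y) -> cover_chain (act s x) (act s y).
  by move=> lt; rewrite -rsx; apply: IHn; rewrite // rsx //; lia.
have [hsx | hsx | hsx] := ltngtP (h (act s x)) (h x).
- have {}IHs := IHs ltac:(lia).
  have := cover_chain_raise sS IHs.
  by rewrite /raise !act_involution // hsx hsy.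
- apply: cover_chain_trans syy.
  apply: cover_chain_trans (cover_chain1 (gen_covers sS hsx)) _.
  have [/IHs // | ge] := ltnP (h (act s x)) (h (act s y)).
  suff <- : act s y = act s x by constructor.
  by rewrite -rsx; apply: reflection_height_eq => //; rewrite rsx; lia.
have sxx : act s x = x by apply: reflection_height_eq; rewrite // gen_reflection.
by apply: cover_chain_trans syy; rewrite -{1}sxx; apply: IHs; lia.
Qed.

Lemma increases_under_parabolic (R : X -> X -> Prop) :
  is_partial_order R ->
  increases_under_reflections <<J>>%g J act height R ->
  increases_under_reflections <<S>>%g S act height R.
Proof.
case=> [Rrefl _ Rtrans] RJ r rT x; rewrite /height lez_nat leq_eqVlt => /orP[/eqP e|].
  by rewrite (reflection_height_eq rT (esym e)).
move=> hx; elim: {hx}(reflection_chain rT hx) => [|y z _ Rxy yz]; first exact: Rrefl.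
apply: Rtrans Rxy _.
case: (yz) => _ _ [_ hz]; case: (covers_sub yz) => r' r'T e; subst z; apply: RJ => //.
by rewrite /height hz lez_nat.
Qed.

End ParabolicOrder.

(** * Signed permutations *)

Definition sabs (w : {perm signed_obj}) (k : 'I_8) : 'I_8 := (w (k, false)).1.
Definition ssgn (w : {perm signed_obj}) (k : 'I_8) : bool := (w (k, false)).2.

Lemma is_signedP (w : {perm signed_obj}) :
  reflect (forall k b, w (k, b) = (sabs w k, b (+) ssgn w k)) (is_signed w).
Proof.
apply: (iffP forallP) => [sw k b | sw k]; last first.
  by apply/forallP => b; rewrite !sw /= addNb.
case: b; last by rewrite addFb /sabs /ssgn -surjective_pairing.
by have /forallP/(_ false)/eqP := sw k.
Qed.

Lemma sabs_inj w : is_signed w -> injective (sabs w).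
Proof.
move=> /is_signedP sw k l kl.
have : w (k, ssgn w k) = w (l, ssgn w l) by rewrite !sw !addbb kl.
by move/perm_inj => [].
Qed.

Lemma is_signed1 : is_signed 1%g.
Proof. by apply/is_signedP=> k b; rewrite /sabs /ssgn !perm1 addbF. Qed.

Lemma is_signedM v w : is_signed v -> is_signed w -> is_signed (v * w)%g.
Proof.
move=> /is_signedP sv /is_signedP sw; apply/is_signedP=> k b.
by rewrite /sabs /ssgn !permM !(sv, sw) /= addbA.
Qed.

Lemma sabsM v w k : is_signed w -> sabs (v * w) k = sabs w (sabs v k).
Proof. by move=> /is_signedP sw; rewrite /sabs permM [v _]surjective_pairing sw. Qed.

Lemma ssgnM v w k :
  is_signed w -> ssgn (v * w) k = ssgn v k (+) ssgn w (sabs v k).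
Proof. by move=> /is_signedP sw; rewrite /ssgn permM [v _]surjective_pairing sw. Qed.

Lemma odd_sign_changes w : odd #|sign_changes w| = \big[addb/false]_k ssgn w k.
Proof.
rewrite -sum1_card big_mkcond (big_morph odd oddD (erefl _)).
by apply: eq_bigr => k _; rewrite inE /ssgn; case: (w _).2.
Qed.

(** The sign of k under v * w is the product of its sign under v and of the sign
    of |v(k)| under w, and k -> |v(k)| is a bijection. *)
Lemma odd_sign_changesM v w : is_signed v -> is_signed w ->
  odd #|sign_changes (v * w)| = odd #|sign_changes v| (+) odd #|sign_changes w|.
Proof.
move=> sv sw; rewrite !odd_sign_changes.
rewrite [X in _ = _ (+) X](reindex_inj (sabs_inj sv)) -big_split /=.
by apply: eq_bigr => k _; apply: ssgnM.
Qed.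

Lemma WD_group_set n : group_set (WD n).
Proof.
apply/group_setP; split=> [|v w].
  rewrite inE is_signed1 odd_sign_changes big1 => [|k _]; last by rewrite /ssgn perm1.
  by apply/forallP=> k; rewrite perm1 eqxx implybT.
rewrite !inE => /and3P[sv ev /forallP fv] /and3P[sw ew /forallP fw].
rewrite is_signedM // odd_sign_changesM // (negPf ev) (negPf ew) /=.
apply/forallP=> k; apply/implyP=> nk.
by move: (fv k) (fw k); rewrite nk permM /= => /eqP->.
Qed.
Canonical WD_group n := Group (WD_group_set n).

Lemma WD_signed n w : w \in WD n -> is_signed w.
Proof. by rewrite inE => /and3P[]. Qed.

(** * The simple reflections of W(D_8) *)

Lemma swapE i j k b : swap i j (k, b) = (tperm (lab i) (lab j) k, b).
Proof.
have inj (c : bool) : injective (pair^~ c : 'I_8 -> signed_obj) by move=> l m [].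
rewrite /swap permM; have e c := inj_tperm (lab i) (lab j) k (inj c).
have fix_other c l : tperm (lab i, ~~ c) (lab j, ~~ c) (l, c) = (l, c).
  by rewrite tpermD ?xpair_eqE; case: c; rewrite ?andbF.
case: b; first by rewrite (fix_other true) (e true).
by rewrite -(e false) (fix_other false).
Qed.

Lemma swap_barE i j k b : lab i != lab j -> swap_bar i j (k, b)
  = (tperm (lab i) (lab j) k, b (+) ((k == lab i) || (k == lab j))).
Proof.
move=> ij; have ji : lab j != lab i by rewrite eq_sym.
rewrite /swap_bar permM !permE /=.
have [-> | ki] := eqVneq k (lab i); [|have [-> | kj] := eqVneq k (lab j)];
  case: b; do 3?rewrite /= ?xpair_eqE ?eqxx ?andbF ?andbT ?(negPf ij) ?(negPf ji) //.
- by rewrite (negPf kj) !xpair_eqE (negPf ki) (negPf kj).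
- by rewrite (negPf ki) !xpair_eqE (negPf ki) (negPf kj).
Qed.

(** As the label written k is the ordinal k - 1, the generator numbered s < 7
    exchanges the ordinals s and s + 1, and the one numbered 7 exchanges 0 and 1
    with a change of sign. Hence s %% 7 is the smaller ordinal moved by gen s. *)
Definition gen (s : nat) : {perm signed_obj} :=
  if s == 7 then swap_bar 1 2 else swap s.+1 s.+2.

Definition adj (i k : nat) : nat :=
  if k == i then i.+1 else if k == i.+1 then i else k.

Lemma val_lab k : 0 < k <= 8 -> lab k = k.-1 :> nat.
Proof. by case: k => // k k8; rewrite /lab inordK. Qed.

Lemma val_tperm_lab s k : s < 7 -> tperm (lab s.+1) (lab s.+2) k = adj s k :> nat.
Proof.
move=> s7; rewrite permE /= /adj -!val_eqE /= !val_lab //; last by lia.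
by case: eqP => _; [|case: eqP => _]; rewrite // val_lab //; lia.
Qed.

Lemma gen_abs s k b : s < 8 -> (gen s (k, b)).1 = adj (s %% 7) k :> nat.
Proof.
move=> s8; rewrite /gen; have [-> | ns] := eqVneq s 7.
  by rewrite swap_barE ?val_tperm_lab // -val_eqE /= !val_lab.
by rewrite swapE val_tperm_lab ?modn_small //; lia.
Qed.

Lemma gen_sgn s k b : (gen s (k, b)).2 = b (+) ((s == 7) && (k < 2)).
Proof.
rewrite /gen; case: eqVneq => [_ | _]; last by rewrite swapE addbF.
rewrite swap_barE; rewrite -?val_eqE /= -?val_eqE /= !val_lab //=.
by case: k => [[|[|k]]].
Qed.

Lemma gen_signed s : s < 8 -> is_signed (gen s).
Proof.
move=> s8; apply/is_signedP => k b; rewrite [LHS]surjective_pairing gen_sgn.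
by congr (_, _); [apply/val_inj; rewrite /sabs /= !gen_abs | rewrite /ssgn gen_sgn
  addFb].
Qed.

Lemma genP s k b : s < 8 ->
  gen s (k, b) = (inord (adj (s %% 7) k), b (+) ((s == 7) && (k < 2))).
Proof.
by move=> s8; rewrite [LHS]surjective_pairing gen_sgn -(gen_abs k b) // inord_val.
Qed.

Lemma adj_inj i j : (forall k, k < 8 -> adj i k = adj j k) -> i < 7 -> j < 7 -> i = j.
Proof.
by rewrite /adj => /(_ i) e i7 j7; move: e; rewrite eqxx; do 2?case: eqP; lia.
Qed.

Lemma gen_inj s t : s < 8 -> t < 8 -> gen s = gen t -> s = t.
Proof.
move=> s8 t8 st; have e: s %% 7 = t %% 7.
  apply: adj_inj; rewrite ?ltn_mod // => k k8.
  by have := gen_abs (Ordinal k8) false s8; rewrite st gen_abs.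
have: (s == 7) = (t == 7).
  by have := gen_sgn s ord0 false; rewrite st gen_sgn !andbT.
by do 2?case: eqP => //; lia.
Qed.

Lemma S_D8P t : reflect (exists2 s, s < 8 & t = gen s) (t \in S_D8).
Proof.
apply: (iffP setU1P) => [[-> | /imsetP[i _ ->]] | [s s8 ->]].
- by exists 7.
- by exists i; rewrite ?ltnS 1?ltnW // /gen ltn_eqF.
rewrite /gen; case: eqVneq => [_ | ns]; [by left | right].
have s7 : s < 7 by lia.
by apply/imsetP; exists (Ordinal s7).
Qed.

Lemma ltn_adj i k : i < 7 -> k < 8 -> adj i k < 8.
Proof. by rewrite /adj; do 2?case: eqP; lia. Qed.

Lemma adjK i : involutive (adj i).
Proof. by move=> k; rewrite /adj; do !case: eqP; lia. Qed.

Lemma gen_involution s : s < 8 -> (gen s * gen s = 1)%g.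
Proof.
move=> s8; apply/permP => -[k b]; rewrite permM perm1 !genP //.
have lt_adj : adj (s %% 7) k < 8 by rewrite ltn_adj // ltn_mod.
congr (_, _); first by apply/val_inj; rewrite /= !inordK ?adjK.
rewrite -addbA inordK //; case: eqP => [-> | _]; last by rewrite addbF.
have -> : adj (7 %% 7) k < 2 = (k < 2) by rewrite /adj; do 2?case: eqP; lia.
by rewrite addbb addbF.
Qed.

(** * Generation of the groups W(D_n) and S_8 *)

(** For n > 1 these are the simple reflections of W(D_n). *)
Definition D_gens (n : nat) : {set {perm signed_obj}} :=
  [set gen s | s : 'I_8 & (s == 7 :> nat) || (s.+1 < n)].

Lemma mem_D_gens n s : s < 8 -> (s == 7) || (s.+1 < n) -> gen s \in D_gens n.
Proof. by move=> s8 sn; apply/imsetP; exists (Ordinal s8); rewrite ?inE. Qed.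

Lemma D_gensS m n : m <= n -> <<D_gens m>>%g \subset <<D_gens n>>%g.
Proof.
move=> mn; apply/genS/subsetP=> _ /imsetP[s + ->]; rewrite inE => sm.
by apply: mem_D_gens => //; case/orP: sm => [-> // | sm];
  rewrite (leq_trans sm) ?orbT.
Qed.

Lemma gen_fixes s n (k : 'I_8) b :
  s < 8 -> 1 < n -> (s == 7) || (s.+1 < n) -> n <= k -> gen s (k, b) = (k, b).
Proof.
move=> s8 n1 sn nk; rewrite genP //; congr (_, _);
  last by rewrite ltnNge (leq_trans n1) // andbF addbF.
by apply/val_inj; rewrite /= inordK /adj; have := ltn_ord k; do 2?case: eqP; lia.
Qed.

Lemma D_gens_sub n : 1 < n -> <<D_gens n>>%g \subset WD n.
Proof.
move=> n1; rewrite gen_subG; apply/subsetP=> _ /imsetP[s + ->]; rewrite inE => sn.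
have s8 := ltn_ord s; rewrite inE gen_signed //=; apply/andP; split; last first.
  by apply/forallP=> k; apply/implyP=> nk; rewrite (gen_fixes _ _ n1).
rewrite odd_sign_changes; under eq_bigr do rewrite /ssgn gen_sgn addFb.
case: eqP => [_ | _] /=; last by rewrite big1.
by rewrite !big_ord_recl big_ord0.
Qed.

Lemma D_gens_up n k : k <= n < 8 ->
  exists2 g, g \in <<D_gens n.+1>>%g & forall b, g (inord k, b) = (inord n, b).
Proof.
elim: n => [|n IHn] /andP[kn n8].
  by exists 1%g; [exact: group1 | move: kn; rewrite leqn0 => /eqP-> b; rewrite perm1].
have [-> | ltkn] := eqVneq k n.+1; first by exists 1%g => [|b];
  rewrite ?group1 ?perm1.
have [|g gn gE] := IHn; first by lia.
have n7: (n == 7) = false by lia.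
exists (g * gen n)%g => [|b].
  rewrite groupM //; first by apply: subsetP gn; apply: D_gensS.
  by apply/mem_gen/mem_D_gens; rewrite ?orbT; lia.
rewrite permM gE genP ?n7 ?addbF 1?ltnW //; congr (_, _); congr inord.
by rewrite inordK ?modn_small /adj ?eqxx //; lia.
Qed.

(** W(D_n+1) is transitive on its signed objects: unsigned exchanges move every
    label to the last one, and the signed one turns the first label into minus
    the second. *)
Lemma D_gens_transitive n k b : 0 < n < 8 -> k <= n ->
  exists2 g, g \in <<D_gens n.+1>>%g & g (inord k, b) = (inord n, false).
Proof.
move=> /andP[n0 n8] kn.
have [|g gn gE] := @D_gens_up n k; first by rewrite kn.
case: b; last by exists g.
have [|g0 g0n g0E] := @D_gens_up n 0; first by rewrite n8.
have [|g1 g1n g1E] := @D_gens_up n 1; first by rewrite n8 n0.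
exists (g * g0^-1 * gen 7 * g1)%g.
  have g7: gen 7 \in <<D_gens n.+1>>%g by apply/mem_gen/mem_D_gens.
  exact: groupM (groupM (groupM gn (groupVr g0n)) g7) g1n.
rewrite (permM _ g1) (permM _ (gen 7)) (permM g) gE -(g0E true) permK genP //=
  inordK //=.
Qed.

Lemma WD1 : WD 1 = 1%g.
Proof.
apply/trivgP/subsetP=> w; rewrite !inE => /and3P[signed_w even /forallP fix_w].
have /is_signedP sw := signed_w.
have fw k : k != ord0 -> w (k, false) = (k, false).
  by move=> k0; apply/eqP; have /implyP := fix_w k; apply; rewrite lt0n.
have w0 : sabs w ord0 = ord0.
  apply/eqP; apply: contraT => k0.
  have /(sabs_inj signed_w) kE : sabs w (sabs w ord0) = sabs w ord0.
    by rewrite {1}/sabs (fw _ k0).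
  by rewrite kE in k0.
have s0 : ssgn w ord0 = false.
  move: even; rewrite odd_sign_changes (bigD1 ord0) //= big1 ?addbF =>
    [/negPf // | k /fw].
  by rewrite /ssgn => ->.
apply/eqP/permP=> -[k b]; rewrite perm1 sw.
by have [-> | /fw e] := eqVneq k ord0; rewrite ?w0 ?s0 /sabs /ssgn ?e addbF.
Qed.

(** Induction on n: any w in W(D_n+1) can be multiplied by a product of
    generators so as to fix the last label, and then lies in W(D_n). *)
Lemma gen_D_gens n : 1 < n <= 8 -> <<D_gens n>>%g = WD n.
Proof.
move=> /andP[n1 n8]; apply/eqP; rewrite eqEsubset D_gens_sub //=.
elim: n n1 n8 => // n IHn n1 n8; apply/subsetP=> w wW.
have n0 : 0 < n by lia.
pose k := sabs w (inord n); pose b := ssgn w (inord n).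
have kn : k <= n.
  rewrite leqNgt; apply/negP=> nk.
  have sw := WD_signed wW; move: wW; rewrite inE => /and3P[_ _ /forallP/(_ k)].
  rewrite nk => /eqP e; have : sabs w k = k by rewrite /sabs e.
  by move/(sabs_inj sw)/(congr1 val) => /= kE; move: nk; rewrite kE inordK // ltnn.
have [|g gn gE] := @D_gens_transitive n k b _ kn; first by rewrite n0.
have wgW : (w * g)%g \in WD n.+1 by rewrite groupM // (subsetP (D_gens_sub n1)).
suff wgn : (w * g)%g \in WD n.
  rewrite -(mulgK g w) groupM ?groupV // (subsetP (D_gensS (leqnSn n))) //.
  case: (ltngtP 1 n) => [n1' | | nE]; [|by lia|].
    by apply: (subsetP (IHn n1' (ltnW n8))).
  by move: wgn; rewrite -nE WD1 => /set1P->; apply: group1.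
move: wgW; rewrite !inE => /and3P[-> -> /forallP fx]; apply/forallP => j;
  apply/implyP.
rewrite leq_eqVlt => /orP[/eqP nj | nj]; last by have := fx j; rewrite nj.
have -> : j = inord n by apply/val_inj; rewrite /= inordK.
have wE : w (inord n, false) = (inord k, b).
  by rewrite inord_val /k /b /sabs /ssgn -surjective_pairing.
by rewrite permM wE gE.
Qed.

(** The embedding of S_8 as the unsigned permutations. *)
Definition unsigned_fun (s : {perm 'I_8}) (p : signed_obj) : signed_obj :=
  (s p.1, p.2).

Lemma unsigned_fun_inj s : injective (unsigned_fun s).
Proof. by move=> [k b] [l c] [/perm_inj-> ->]. Qed.

Definition unsigned s : {perm signed_obj} := perm (@unsigned_fun_inj s).

Lemma unsignedE s k b : unsigned s (k, b) = (s k, b).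
Proof. by rewrite permE. Qed.

Lemma unsignedM : {in [set: {perm 'I_8}] &, {morph unsigned : s t / (s * t)%g}}.
Proof. by move=> s t _ _; apply/permP => -[k b]; rewrite !(permM, unsignedE). Qed.
Canonical unsigned_morphism := Morphism unsignedM.

Lemma unsigned_signed s : is_signed (unsigned s).
Proof. by apply/is_signedP=> k b; rewrite /sabs /ssgn !unsignedE addbF. Qed.

Lemma sign_changes_unsigned s : sign_changes (unsigned s) = set0.
Proof. by apply/setP=> k; rewrite !inE unsignedE. Qed.

Lemma gen_unsigned s : s < 7 -> gen s = unsigned (tperm (lab s.+1) (lab s.+2)).
Proof.
by move=> s7; apply/permP=> -[k b]; rewrite unsignedE /gen ltn_eqF // swapE.
Qed.

(** The transpositions (0 k) generate S_8, and (0 k+1) is the conjugate of (0 k)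
    by (k k+1). *)
Lemma gen_simple_transpositions : <<simple_transpositions>>%g = [set: {perm 'I_8}].
Proof.
apply/eqP; rewrite -subTset -(gen_tperm ord0) gen_subG;
  apply/subsetP=> _ /imsetP[k _ ->].
case: k; elim=> [|k IHk] k8.
  by rewrite (_ : Ordinal k8 = ord0) ?tperm1 ?group1 //; apply: val_inj.
have {IHk} := IHk (ltnW k8); set l := Ordinal _ => IH; set l' := Ordinal _.
have t : tperm l l' \in <<simple_transpositions>>%g.
  have k7 : k < 7 by [].
  apply/mem_gen/imsetP; exists (Ordinal k7) => //.
  by congr tperm; apply: val_inj; rewrite /= val_lab //= ltnW.
have [l0 | l0] := eqVneq l ord0; first by rewrite -l0.
suff -> : tperm ord0 l' = (tperm ord0 l ^ tperm l l')%g by rewrite groupJ.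
by rewrite tpermJ tpermL tpermD // -val_eqE.
Qed.

Lemma unsigned_S8E : unsigned_S8 = unsigned @: [set: {perm 'I_8}].
Proof.
apply/setP=> w; apply/idP/imsetP=> [|[s _ ->]]; last first.
  by rewrite inE unsigned_signed sign_changes_unsigned eqxx.
rewrite inE => /andP[sw /eqP/setP w0].
exists (perm (sabs_inj sw)); rewrite ?inE //; apply/permP => -[k b].
rewrite unsignedE permE; move/is_signedP: sw => ->; congr (_, _).
by have := w0 k; rewrite !inE -/(ssgn w k) => ->; rewrite addbF.
Qed.

Definition A_gens : {set {perm signed_obj}} := [set gen s | s : 'I_7].

Lemma gen_A_gens : <<A_gens>>%g = unsigned_S8.
Proof.
rewrite unsigned_S8E -gen_simple_transpositions.
have imE (A : {set {perm 'I_8}}) : (unsigned_morphism @* A)%g = unsigned @: A.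
  by rewrite morphimEsub ?subsetT.
rewrite -imE morphim_gen ?subsetT // imE /simple_transpositions; congr <<_>>%g.
rewrite -imset_comp; apply: eq_imset => s /=; exact: gen_unsigned.
Qed.

(** * Signed permutations acting on cosets of U *)

Definition setvec (A : {set 'I_8}) : 'rV['F_2]_8 := (\sum_(i in A) eps i)%R.

Lemma setvecE A j : setvec A 0%R j = ((j \in A)%:R)%R.
Proof.
rewrite /setvec summxE (eq_bigr (fun i => ((i == j)%:R)%R)) => [|i _]; last first.
  by rewrite mxE eqxx eq_sym.
have [jA | jA] := boolP (j \in A).
  by rewrite (bigD1 j) //= eqxx big1 ?addr0 // => i /andP[_ /negPf->].
by rewrite big1 // => i iA; case: eqP => // ij; rewrite -ij iA in jA.
Qed.

Lemma natr_F2_addb (b c : bool) : (b%:R + c%:R = (b (+) c)%:R :> 'F_2)%R.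
Proof. by case: b c => [] [] //; apply: val_inj. Qed.

Lemma natr_F2_inj (b c : bool) : (b%:R = c%:R :> 'F_2)%R -> b = c.
Proof. by case: b c => [] [] // /eqP; rewrite // eq_sym. Qed.

Lemma setvec_inj : injective setvec.
Proof.
by move=> A B /rowP AB; apply/setP => j; apply: natr_F2_inj; rewrite -!setvecE.
Qed.

Lemma vcosetE A : vcoset A = setvec @: [set A; ~: A].
Proof.
have setT1 : (const_mx 1 = setvec [set: 'I_8])%R.
  by apply/rowP => j; rewrite setvecE mxE inE.
have setvecC : (setvec A + const_mx 1 = setvec (~: A))%R.
  by rewrite setT1; apply/rowP => j; rewrite mxE !setvecE natr_F2_addb !inE addbT.
rewrite imsetU1 imset_set1; apply/setP => v; apply/imsetP/set2P.
  move=> [u /vlineP[c ->] ->]; rewrite -/(setvec A).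
  have /orP[/eqP-> | /eqP->] : (c == 0%R) || (c == 1%R) by case: c => [[|[|]]].
    by left; rewrite scale0r addr0.
  by right; rewrite scale1r setvecC.
case=> ->; first by exists 0%R; rewrite ?mem0v // addr0.
by exists (const_mx 1%R); rewrite ?memv_line // -setvecC.
Qed.

Lemma vcosetC A : vcoset (~: A) = vcoset A.
Proof. by rewrite !vcosetE setCK setUC. Qed.

(** A coset of U determines a set of labels up to complement. *)
Lemma vcoset_eq A B : vcoset A = vcoset B -> A = B \/ A = ~: B.
Proof.
rewrite !vcosetE => /(imset_inj setvec_inj)/setP/(_ A).
by rewrite set21 => /esym/set2P.
Qed.

(** A set of labels is a choice of one object among k and -k for each label k,
    negative for the labels of the set; signed permutations carry such choices
    to each other. *)
Definition signed_set (w : {perm signed_obj}) (A : {set 'I_8}) : {set 'I_8} :=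
  [set (w (k, k \in A)).1 | k : 'I_8 & (w (k, k \in A)).2].

Lemma mem_signed_set w A k : is_signed w ->
  (sabs w k \in signed_set w A) = (k \in A) (+) ssgn w k.
Proof.
move=> sw; have /is_signedP wE := sw; apply/imsetP/idP => [[l] | kA].
  by rewrite inE !wE /= => /[swap] /(sabs_inj sw) ->.
by exists k; rewrite ?inE wE.
Qed.

Lemma sabs_onto w j : is_signed w -> exists k, j = sabs w k.
Proof.
by move=> sw; have [f _ fK] := injF_bij (sabs_inj sw); exists (f j); rewrite fK.
Qed.

Lemma eq_set_sabs w (A B : {set 'I_8}) : is_signed w ->
  (forall k, (sabs w k \in A) = (sabs w k \in B)) -> A = B.
Proof. by move=> sw AB; apply/setP => j; have [k ->] := sabs_onto j sw. Qed.

Lemma signed_setM v w A : is_signed v -> is_signed w ->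
  signed_set (v * w) A = signed_set w (signed_set v A).
Proof.
move=> sv sw; have svw := is_signedM sv sw; apply: (eq_set_sabs svw) => k.
by rewrite mem_signed_set // sabsM // !mem_signed_set // ssgnM // addbA.
Qed.

Lemma signed_set1 A : signed_set 1 A = A.
Proof.
apply: (eq_set_sabs is_signed1) => k; rewrite (mem_signed_set _ _ is_signed1).
by rewrite /ssgn /sabs perm1 addbF.
Qed.

Lemma signed_setC w A : is_signed w -> signed_set w (~: A) = ~: signed_set w A.
Proof.
move=> sw; apply: (eq_set_sabs sw) => k.
by rewrite inE !mem_signed_set // inE addNb.
Qed.

Lemma signed_vect_setvec w A : is_signed w ->
  signed_vect w (setvec A) = setvec (signed_set w A).
Proof.
move=> sw; apply/rowP => j; have [k ->] := sabs_onto j sw.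
rewrite setvecE mem_signed_set // -natr_F2_addb /signed_vect mxE !summxE;
  congr (_ + _)%R.
  rewrite (bigD1 k) //= big1 => [|l lk];
    rewrite !mxE setvecE eqxx -?/(sabs w _) ?eqxx ?addr0 ?mulr1 //.
  by rewrite eq_sym (inj_eq (sabs_inj sw)) (negPf lk) mulr0.
rewrite (eq_bigr (fun i => ((i == k)%:R)%R)) => [|i _]; last first.
  by rewrite mxE eqxx -/(sabs w i) (inj_eq (sabs_inj sw)) eq_sym.
have [wk | wk] := boolP (ssgn w k).
  by rewrite (bigD1 k) ?inE //= eqxx big1 ?addr0 // => i /andP[_ /negPf->].
by rewrite big1 // => i; rewrite inE; case: eqP => // -> kw;
  rewrite [ssgn w k]kw in wk.
Qed.

Lemma signed_vect_vcoset w A : is_signed w ->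
  signed_vect w @: vcoset A = vcoset (signed_set w A).
Proof.
move=> sw; rewrite !vcosetE !imsetU !imset_set1 -signed_setC //.
by rewrite !signed_vect_setvec.
Qed.

Lemma signed_image_vcoset w (B : {set {set 'I_8}}) : is_signed w ->
  signed_image w (vcoset @: B) = vcoset @: (signed_set w @: B).
Proof.
move=> sw; rewrite /signed_image -!imset_comp; apply: eq_imset => A /=.
exact: signed_vect_vcoset.
Qed.

(** * Labelled Fano planes *)

Definition fano_base (x : Omega240) : {set {set 'I_8}} :=
  val x :|: [set [set l] | l in ~: cover (val x)].

Lemma lambda_minusE x : lambda_minus x = vcoset @: fano_base x.
Proof. by rewrite imsetU -imset_comp. Qed.

Lemma signed_image1 x : signed_image 1 (lambda_minus x) = lambda_minus x.
Proof.
rewrite lambda_minusE signed_image_vcoset ?is_signed1 //.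
by rewrite (eq_imset _ signed_set1) imset_id.
Qed.

Lemma signed_imageM v w x : is_signed v -> is_signed w ->
  signed_image (v * w) (lambda_minus x)
  = signed_image w (signed_image v (lambda_minus x)).
Proof.
move=> sv sw; rewrite lambda_minusE !signed_image_vcoset ?is_signedM //.
rewrite -[in RHS](imset_comp (signed_set w)).
by rewrite (eq_imset _ (fun A => signed_setM A sv sw)).
Qed.

Lemma addr_F2_eq0 (u v : 'rV['F_2]_3) : (u + v == 0 :> 'rV_3)%R = (u == v).
Proof.
have vN : (- v = v)%R.
  by apply/rowP => j; rewrite mxE; case: (v _ j) => [[|[|]]] //= ?; apply: val_inj.
by rewrite -[RHS]subr_eq0 vN.
Qed.

Lemma pg22_line0 l : l \in pg22_lines -> 0%R \notin l.
Proof.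
rewrite inE => /existsP[u /existsP[v /and4P[u0 v0 uv /eqP->]]].
by rewrite !inE ![(0 == _)%R]eq_sym addr_F2_eq0 (negPf u0) (negPf v0) (negPf uv).
Qed.

(** The eighth label completes the labelling of the seven points to a bijection
    from F_2^3, the zero vector receiving the basepoint. *)
Lemma labelled_fanoP x : reflect
  (exists2 f : 'rV['F_2]_3 -> 'I_8,
    bijective f & x = [set f @: (l : {set _}) | l in pg22_lines])
  (labelled_fano x).
Proof.
have card8 : #|{: 'rV['F_2]_3}| = #|'I_8| by rewrite card_mx card_ord card_Fp.
apply: (iffP existsP) => [[f /andP[/dinjectiveP f_inj /eqP->]] | [f [g fK _] ->]];
  last first.
  exists (finfun f); apply/andP; split.
    by apply/dinjectiveP => u v _ _; rewrite !ffunE; apply: (can_inj fK).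
  by apply/eqP/eq_in_imset => l _; apply: eq_imset => u; rewrite ffunE.
have /subsetPn[b _ bf] : ~~ ([set: 'I_8] \subset f @: [set~ 0%R]).
  apply: contraTN isT => /subset_leq_card le8.
  by have := leq_trans le8 (leq_imset_card _ _);
    rewrite cardsT cardsC1 card8 card_ord.
exists (fun u => if u == 0%R then b else f u).
  apply: inj_card_bij; last by rewrite card8.
  have neq_b u : u != 0%R -> f u != b.
    by move=> u0; apply: contraNneq bf => <-; apply: imset_f; rewrite !inE.
  move=> u v; case: eqVneq => [-> | u0]; case: eqVneq => [-> | v0] //.
  - by move=> e; have := neq_b v v0; rewrite e eqxx.
  - by move=> e; have := neq_b u u0; rewrite e eqxx.
  - exact: f_inj.
apply: eq_in_imset => l /pg22_line0 l0; apply: eq_in_imset => u ul.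
by case: eqP => // u0; rewrite -u0 ul in l0.
Qed.

Lemma relabel_fano s x : labelled_fano x -> labelled_fano (relabel s x).
Proof.
move=> /labelled_fanoP[f bij_f ->]; apply/labelled_fanoP.
exists (s \o f); first by apply: bij_comp bij_f; exists s^-1%g;
  [apply: permK | apply: permKV].
by rewrite /relabel -imset_comp; apply: eq_imset => l; rewrite /= -imset_comp.
Qed.

(** Both planes are images of PG(2,2) under bijections from F_2^3 to the labels,
    and the quotient of these bijections is a permutation of the labels. *)
Lemma fano_relabel x y :
  labelled_fano x -> labelled_fano y -> exists s, y = relabel s x.
Proof.
move=> /labelled_fanoP[f [f' fK f'K] ->] /labelled_fanoP[g bij_g ->].
have s_inj : injective (g \o f') by apply: inj_comp (bij_inj bij_g) (can_inj f'K).
exists (perm s_inj); rewrite /relabel -imset_comp; apply: eq_imset => l /=.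
by rewrite -imset_comp; apply: eq_imset => u; rewrite /= permE /= fK.
Qed.

Lemma card_fano_triple (x : Omega240) A : A \in val x -> #|A| = 3.
Proof.
have [f [g fK _] ->] := labelled_fanoP _ (valP x) => /imsetP[l + ->].
rewrite (card_imset _ (can_inj fK)) inE.
move=> /existsP[u /existsP[v /and4P[u0 v0 uv /eqP->]]].
have e1 : (u + v == u)%R = (v == 0)%R by rewrite -subr_eq0 addrC addKr.
have e2 : (u + v == v)%R = (u == 0)%R by rewrite -subr_eq0 addrK.
by rewrite setUC cardsU1 cards2 uv !inE e1 e2 (negPf u0) (negPf v0).
Qed.

(** A triple is neither a singleton nor the complement of a triple or of a
    singleton, as these have 1, 5 and 7 elements. *)
Lemma lambda_minus_inj : injective lambda_minus.
Proof.
suff sub (x y : Omega240) : lambda_minus x = lambda_minus y -> val x \subset val y.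
  by move=> x y xy; apply/val_inj/eqP; rewrite eqEsubset !sub.
rewrite !lambda_minusE => xy; apply/subsetP => A Ax; have A3 := card_fano_triple Ax.
have : vcoset A \in vcoset @: fano_base x by rewrite imset_f // inE Ax.
rewrite xy => /imsetP[B By AB].
have B31 : B \in val y \/ #|B| = 1.
  by move: By; case/setUP => [-> | /imsetP[l _ ->]]; [left | right; rewrite cards1].
have := cardsC B; rewrite card_ord => cB.
have [e | e] := vcoset_eq AB; rewrite -?e A3 in cB.
  by case: B31; rewrite -e // A3.
case: B31 => [/card_fano_triple | ] e1; rewrite e1 in cB; lia.
Qed.

Lemma fano_base_relabel s x y : val y = relabel s (val x) ->
  fano_base y = [set s @: (A : {set 'I_8}) | A in fano_base x].
Proof.
move=> yE; rewrite /fano_base yE /relabel imsetU -!imset_comp; congr (_ :|: _).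
have -> : cover [set s @: (A : {set 'I_8}) | A in val x] = s @: cover (val x).
  by rewrite cover_imset -(big_morph _ (imsetU s) (imset0 s)).
have -> : ~: (s @: cover (val x)) = s @: ~: cover (val x).
  by rewrite !(can_imset_pre _ (permK s)) preimsetC.
rewrite -(imset_comp set1 s); apply: eq_imset => l /=; exact/esym/imset_set1.
Qed.

Lemma signed_set_unsigned s A : signed_set (unsigned s) A = s @: A.
Proof.
apply: (eq_set_sabs (unsigned_signed s)) => k;
  rewrite mem_signed_set ?unsigned_signed //.
by rewrite /ssgn /sabs unsignedE /= addbF mem_imset //; apply: perm_inj.
Qed.

Lemma lambda_minus_relabel s x y : val y = relabel s (val x) ->
  lambda_minus y = signed_image (unsigned s) (lambda_minus x).
Proof.
move=> yE; rewrite !lambda_minusE signed_image_vcoset ?unsigned_signed //.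
by rewrite (fano_base_relabel yE) (eq_imset _ (signed_set_unsigned s)).
Qed.

Lemma signed_actE w x y :
  lambda_minus y = signed_image w (lambda_minus x) -> signed_act w x = y.
Proof.
move=> yE; rewrite /signed_act; case: pickP => [z /eqP zE | /(_ y)];
  last by rewrite yE eqxx.
by apply: lambda_minus_inj; rewrite zE yE.
Qed.

Lemma signed_act_unsigned s x : val (signed_act (unsigned s) x) = relabel s (val x).
Proof.
pose y : Omega240 := exist labelled_fano _ (relabel_fano s (valP x)).
by rewrite (@signed_actE _ x y) //; apply: lambda_minus_relabel.
Qed.

(** * The 240 packings in coordinates *)

(** An element of Lambda^- is a set of labels up to complement; it is encoded by
    the indicator, of length 7, of its representative avoiding the last label. *)
Definition bits_set (b : bitseq) : {set 'I_8} := [set k : 'I_8 | nth false b k].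

(** Whether k belongs to the image under gen s of the set with indicator b. *)
Definition gen_bit (s : nat) (b : bitseq) (k : nat) : bool :=
  nth false b (adj (s %% 7) k) (+) ((s == 7) && (k < 2)).

(** Adding the bit of the last label takes the complement if that label is
    present. *)
Definition gen_bits (s : nat) (b : bitseq) : bitseq :=
  mkseq (fun k => gen_bit s b k (+) gen_bit s b 7) 7.

Lemma vcoset_gen_bits s b : s < 8 ->
  vcoset (signed_set (gen s) (bits_set b)) = vcoset (bits_set (gen_bits s b)).
Proof.
move=> s8; have sg := gen_signed s8.
have mem_img (k : 'I_8) : (k \in signed_set (gen s) (bits_set b)) = gen_bit s b k.
  have [l ->] := sabs_onto k sg; rewrite mem_signed_set // inE /gen_bit.
  rewrite /sabs gen_abs // adjK /ssgn gen_sgn addFb; congr (_ (+) _).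
  by case: eqP => [->|//] /=; rewrite /adj; do 2?case: eqP; lia.
have mem_bits (k : 'I_8) :
    (k \in bits_set (gen_bits s b)) = gen_bit s b k (+) gen_bit s b 7.
  rewrite inE; have [k7 | k7] := ltnP k 7; first by rewrite nth_mkseq.
  have -> : k = 7 :> nat by have := ltn_ord k; lia.
  by rewrite addbb nth_default ?size_mkseq.
have [b7 | b7] := boolP (gen_bit s b 7); last first.
  by congr vcoset; apply/setP=> k; rewrite mem_img mem_bits (negPf b7) addbF.
rewrite -vcosetC; congr vcoset; apply/setP=> k.
by rewrite inE mem_img mem_bits b7 addbT.
Qed.

Lemma vcoset_bits_inj b c : size b = 7 -> size c = 7 ->
  vcoset (bits_set b) = vcoset (bits_set c) -> b = c.
Proof.
move=> b7 c7 /vcoset_eq[] /setP bc.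
  apply: (@eq_from_nth _ false); rewrite b7 ?c7 // => k k7.
  by have := bc (Ordinal (ltnW k7 : k < 8)); rewrite !inE.
by have := bc ord_max; rewrite !inE !nth_default ?b7 ?c7.
Qed.

Fixpoint lex_bits (b c : bitseq) : bool :=
  match b, c with
  | x :: b', y :: c' => if x == y then lex_bits b' c' else y
  | _, _ => true
  end.

(** A packing is encoded by the eight elements of lambda^-(x), sorted so that
    equal packings have equal codes. *)
Definition gen_code (s : nat) (c : seq bitseq) : seq bitseq :=
  sort lex_bits [seq gen_bits s b | b <- c].

Definition x0_lines : seq (seq nat) :=
  [:: [:: 1; 2; 7]; [:: 1; 3; 6]; [:: 1; 4; 5]; [:: 2; 3; 5];
      [:: 2; 4; 6]; [:: 3; 4; 7]; [:: 5; 6; 7]].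

Definition label_bits (t : seq nat) : bitseq := mkseq (fun k => k.+1 \in t) 7.

(** The basepoint 8 of x0 is represented by the complement of {8}. *)
Definition code0 : seq bitseq :=
  sort lex_bits [seq label_bits t | t <- iota 1 7 :: x0_lines].

(** Breadth-first search from code0 under the generators of S_8. A generator
    changes the height by at most 1, so a new code need only be compared with
    the last two layers. *)
Fixpoint code_layers (n : nat) (prev cur : seq (seq bitseq)) :=
  if n is m.+1 then
    cur :: code_layers m cur
      [seq c <- undup [seq gen_code s c | c <- cur, s <- iota 0 7]
      | c \notin prev ++ cur]
  else [::].

Definition codes : seq (seq bitseq) :=
  Eval vm_compute in flatten (code_layers 15 [::] [:: code0]).

(** The breadth-first layers of the search have heights 0, 1, ..., 14. *)
Definition height_table : seq nat :=
  Eval vm_compute in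
    let layers := code_layers 15 [::] [:: code0] in
    flatten [seq nseq (size (nth [::] layers n)) n | n <- iota 0 (size layers)].

Definition gen_table : seq (seq nat) :=
  Eval vm_compute in
    [seq [seq index (gen_code s c) codes | c <- codes] | s <- iota 0 8].

Definition code i := nth [::] codes i.
Definition height_at i := nth 0 height_table i.
Definition act_index s i := nth 0 (nth [::] gen_table s) i.

(** lambda^-(x) is an affine subspace of dimension 3 in Lambda^-, on which a
    reflection acts as a transvection. Hence, unless r x = x, the subspace
    lambda^-(r x) meets lambda^-(x) in the plane of points fixed by r. Listing
    the packings whose subspace meets that of x in 4 points therefore gives a
    set that contains all r x; it has 14 elements. *)
Definition neighbour_table : seq (seq nat) :=
  Eval vm_compute in
    [seq [seq j <- iota 0 240 | count (mem (nth [::] codes j)) c == 4] | c <- codes].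

Definition neighbours i := nth [::] neighbour_table i.

Opaque code height_at act_index neighbours.

Definition all_codes (P : pred nat) : bool := all P (iota 0 240).
Definition all_moves (P : nat -> pred nat) : bool :=
  all (fun s => all_codes (P s)) (iota 0 8).

Lemma all_codesP P i : all_codes P -> i < 240 -> P i.
Proof. by move=> /allP PI i240; apply: PI; rewrite mem_iota. Qed.

Lemma all_movesP P s i : all_moves P -> s < 8 -> i < 240 -> P s i.
Proof.
move=> /allP PI s8; apply: all_codesP.
by apply: (PI s); rewrite mem_iota.
Qed.

(** The facts about the tables that the proof uses, each of them decided by
    running through all codes and all generators. *)
Definition bits_ok i := all (fun b => size b == 7) (code i).
Definition unique_ok i := (i == 0) || ~~ all (mem (code 0)) (code i).
Definition act_index_ok s i :=
  [&& act_index s i < 240, act_index s (act_index s i) == i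
    & code (act_index s i) == gen_code s (code i)].
Definition height_at_ok s i :=
  (height_at (act_index s i) <= (height_at i).+1) &&
    (height_at i <= (height_at (act_index s i)).+1).
Definition height_at_bound_ok i := height_at i <= 14.
Definition descent_ok (gens : seq nat) i :=
  has (fun s => height_at (act_index s i) < height_at i) gens || (i == 0).
Definition neighbour_ok s i :=
  (act_index s i \in neighbours i) &&
  all (mem (neighbours (act_index s i))) [seq act_index s j | j <- neighbours i].
Definition qp1_ok i := all (fun j => height_at j != height_at i) (neighbours i).
Definition qp2_ok s i := all (fun j =>
  (height_at i < height_at j) ==> (height_at (act_index s j) < height_at (act_index
    s i)) ==>
  (j == act_index s i))
  (neighbours i).

Lemma size_code_bits i b : i < 240 -> b \in code i -> size b = 7.
Proof.
have check : all_codes bits_ok by vm_compute.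
by move=> i240; have /allP bits7 := all_codesP check i240; move=> /bits7/eqP.
Qed.

Lemma act_index_codes s i : s < 8 -> i < 240 ->
  [/\ act_index s i < 240, act_index s (act_index s i) = i
    & code (act_index s i) = gen_code s (code i)].
Proof.
have check : all_moves act_index_ok by vm_compute.
move=> s8 i240; have ok := all_movesP check s8 i240.
case/and3P: ok => lt_img /eqP imgK /eqP code_img.
exact: And3 lt_img imgK code_img.
Qed.

Lemma code0_unique i : i < 240 -> {subset code i <= code 0} -> i = 0.
Proof.
have check : all_codes unique_ok by vm_compute.
move=> i240 /allP sub; apply/eqP.
by have := all_codesP check i240; rewrite /unique_ok sub orbF.
Qed.

Lemma height_at_le14 i : i < 240 -> height_at i <= 14.
Proof.
have check : all_codes height_at_bound_ok by vm_compute.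
by move=> i240; have := all_codesP check i240.
Qed.

Lemma height_at_step s i : s < 8 -> i < 240 ->
  (height_at (act_index s i) <= (height_at i).+1) &&
    (height_at i <= (height_at (act_index s i)).+1).
Proof.
have check : all_moves height_at_ok by vm_compute.
by move=> s8 i240; have := all_movesP check s8 i240.
Qed.

Lemma height_at_descent gens i : gens \in [:: iota 0 7; 7 :: iota 0 4] -> i < 240 ->
  i != 0 -> exists2 s, s \in gens & height_at (act_index s i) < height_at i.
Proof.
have check : all (fun gens => all_codes (descent_ok gens))
  [:: iota 0 7; 7 :: iota 0 4] by vm_compute.
move=> gensP i240 /negPf i0.
have := all_codesP (allP check gens gensP) i240.
by rewrite /descent_ok i0 orbF => /hasP.
Qed.

(** As reflections are conjugates of simple ones, it follows that all r x are
    neighbours of x. *)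
Lemma act_index_neighbour s i : s < 8 -> i < 240 -> act_index s i \in neighbours i /\
  {in neighbours i, forall j, act_index s j \in neighbours (act_index s i)}.
Proof.
have check : all_moves neighbour_ok by vm_compute.
move=> s8 i240; have /andP[ij /allP N] := all_movesP check s8 i240.
split; first exact: ij.
by move=> j jN; apply: N; apply: map_f.
Qed.

Lemma neighbour_height i j : i < 240 -> j \in neighbours i ->
  height_at j != height_at i.
Proof.
have check : all_codes qp1_ok by vm_compute.
by move=> i240; have /allP := all_codesP check i240; apply.
Qed.

Lemma neighbour_exchange s i j : s < 8 -> i < 240 -> j \in neighbours i ->
  height_at i < height_at j -> height_at (act_index s j) < height_at (act_index s
    i) -> j = act_index s i.
Proof.
have check : all_moves qp2_ok by vm_compute.
move=> s8 i240 ij ltij lts; have /allP/(_ j ij) := all_movesP check s8 i240.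
by rewrite ltij lts => /eqP.
Qed.

(** * Packings and their codes *)

Definition code_cosets (c : seq bitseq) : {set {set 'rV['F_2]_8}} :=
  [set:: [seq vcoset (bits_set b) | b <- c]].

Lemma signed_image_code s c : s < 8 ->
  signed_image (gen s) (code_cosets c) = code_cosets (gen_code s c).
Proof.
move=> s8; have sg := gen_signed s8.
have imE b : signed_vect (gen s) @: vcoset (bits_set b)
  = vcoset (bits_set (gen_bits s b)).
  by rewrite signed_vect_vcoset // vcoset_gen_bits.
apply/setP=> C; rewrite inE; apply/imsetP/mapP.
  move=> [D]; rewrite inE => /mapP[b bc ->] ->.
  by exists (gen_bits s b); rewrite ?imE // mem_sort; apply: map_f bc.
move=> [d]; rewrite mem_sort => /mapP[b bc ->] ->.
exists (vcoset (bits_set b)); rewrite ?imE // inE.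
exact: (map_f (fun b => vcoset (bits_set b)) bc).
Qed.

Definition represents (i : nat) (x : Omega240) : bool :=
  lambda_minus x == code_cosets (code i).

Lemma fano_base_x0 :
  fano_base x0 = [set:: [seq bits_set (label_bits t) | t <- x0_lines]] :|: [set
    [set lab 8]].
Proof.
have tripleE i j k : 0 < i < 8 -> 0 < j < 8 -> 0 < k < 8 ->
    triple i j k = bits_set (label_bits [:: i; j; k]).
  move=> i8 j8 k8; apply/setP=> l; rewrite !inE -!val_eqE /= !val_lab; try lia.
  have [l7 | l7] := ltnP l 7; first by rewrite nth_mkseq // !inE; lia.
  by rewrite nth_default ?size_mkseq //; lia.
have valE : val x0 = [set:: [seq bits_set (label_bits t) | t <- x0_lines]].
  rewrite /= /x0_triples !tripleE //; apply/setP=> A; rewrite !inE.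
  by rewrite !orbA.
rewrite /fano_base valE; congr (_ :|: _).
suff -> : cover [set:: [seq bits_set (label_bits t) | t <- x0_lines]]
  = ~: [set lab 8].
  by rewrite setCK imset_set1.
have lab8 (l : 'I_8) : (l == lab 8) = (l == 7 :> nat) by rewrite -val_eqE /= val_lab.
apply/setP=> l; rewrite in_setC in_set1 lab8; apply/bigcupP/idP.
  move=> [A]; rewrite in_set => /mapP[t _ ->]; rewrite in_set;
    apply: contraTneq => ->.
  by rewrite nth_default ?size_mkseq.
move=> l7; have {}l7 : l < 7 by have := ltn_ord l; lia.
have /hasP[t tL lt] : has (fun t => nth false (label_bits t) l) x0_lines.
  by case: l l7 => [[|[|[|[|[|[|[|]]]]]]]].
by exists (bits_set (label_bits t)); rewrite in_set //;
  apply: (map_f (fun t => bits_set (label_bits t)) tL).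
Qed.

Lemma represents_x0 : represents 0 x0.
Proof.
have code0E : code 0 = code0 by vm_compute.
have lab8 : vcoset [set lab 8] = vcoset (bits_set (label_bits (iota 1 7))).
  rewrite -vcosetC; congr vcoset; apply/setP=> l;
    rewrite !inE -val_eqE /= val_lab //=.
  by case: l => [[|[|[|[|[|[|[|[|]]]]]]]]].
apply/eqP; rewrite lambda_minusE fano_base_x0 imsetU imset_set1 code0E lab8.
apply/setP=> C; rewrite in_setU in_set1 in_set.
apply/orP/mapP => [[/imsetP[A] | /eqP->] | [b]].
- rewrite in_set => /mapP[t tL ->] ->; exists (label_bits t) => //.
  by rewrite mem_sort map_f // in_cons tL orbT.
- by exists (label_bits (iota 1 7)); rewrite // mem_sort map_f // mem_head.
rewrite mem_sort => /mapP[t]; rewrite in_cons => /orP[/eqP-> | tL] -> ->;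
  first by right.
left; apply: imset_f; rewrite in_set.
exact: (map_f (fun t => bits_set (label_bits t)) tL).
Qed.

Lemma represents_image s i x y : s < 8 -> i < 240 -> represents i x ->
  lambda_minus y = signed_image (gen s) (lambda_minus x) ->
    represents (act_index s i) y.
Proof.
move=> s8 i240 /eqP ix yE; have [_ _ e] := act_index_codes s8 i240.
by rewrite /represents yE ix signed_image_code // e.
Qed.

Lemma represents_inj i x y : represents i x -> represents i y -> x = y.
Proof. by move=> /eqP ix /eqP iy; apply: lambda_minus_inj; rewrite ix iy. Qed.

Lemma signed_act_simple s x : s < 7 ->
  lambda_minus (signed_act (gen s) x) = signed_image (gen s) (lambda_minus x).
Proof.
move=> s7; rewrite gen_unsigned //; apply: lambda_minus_relabel.
exact: signed_act_unsigned.
Qed.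

Lemma represents_simple s i x : s < 7 -> i < 240 -> represents i x ->
  represents (act_index s i) (signed_act (gen s) x).
Proof.
move=> s7 i240 ix; apply: (represents_image (ltnW s7) i240 ix).
exact: signed_act_simple.
Qed.

(** Every code is reached from code 0, by reversing a sequence of descents. *)
Lemma code_represents i : i < 240 -> exists x, represents i x.
Proof.
have [n] := ubnP (height_at i); elim: n i => // n IHn i lt_in i240.
have [-> | i0] := eqVneq i 0; first by exists x0; apply: represents_x0.
have [s] := height_at_descent (mem_head _ _) i240 i0; rewrite mem_iota => /= s7 lt_s.
have [lt_img imgK _] := act_index_codes (ltnW s7) i240.
have [x ix] := IHn _ (leq_trans lt_s lt_in) lt_img.
by exists (signed_act (gen s) x); rewrite -imgK; apply: represents_simple.
Qed.

(** The image of a code under gen s is again in the table, hence is the code of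
    a packing, including for the signed exchange, which is not a relabelling. *)
Lemma signed_act_gen s i x : s < 8 -> i < 240 -> represents i x ->
  lambda_minus (signed_act (gen s) x) = signed_image (gen s) (lambda_minus x).
Proof.
move=> s8 i240 ix; have [lt_img _ codeE] := act_index_codes s8 i240.
have [y /eqP yE] := code_represents lt_img.
suff yx : lambda_minus y = signed_image (gen s) (lambda_minus x)
  by rewrite (signed_actE yx).
by rewrite (eqP ix) signed_image_code // yE codeE.
Qed.

Lemma represents_gen s i x : s < 8 -> i < 240 -> represents i x ->
  represents (act_index s i) (signed_act (gen s) x).
Proof.
by move=> s8 i240 ix; apply: (represents_image s8 i240 ix); apply: signed_act_gen ix.
Qed.

Lemma relabelM s t x : relabel (s * t) x = relabel t (relabel s x).
Proof.
rewrite /relabel -imset_comp; apply: eq_imset => A /=.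
by rewrite -imset_comp; apply: eq_imset => k; rewrite /= permM.
Qed.

Lemma relabel1 x : relabel 1 x = x.
Proof.
rewrite /relabel (eq_imset (g := id)) ?imset_id // => A.
by rewrite (eq_imset (g := id)) ?imset_id // => k; rewrite perm1.
Qed.

Lemma simple_transpositionP t : t \in simple_transpositions ->
  exists2 s, s < 7 & t = tperm (lab s.+1) (lab s.+2).
Proof. by case/imsetP=> s _ ->; exists s. Qed.

Lemma val_act_simple s x : s < 7 ->
  val (signed_act (gen s) x) = relabel (tperm (lab s.+1) (lab s.+2)) (val x).
Proof. by move=> s7; rewrite gen_unsigned // signed_act_unsigned. Qed.

(** All packings are relabellings of x0, and S_8 is generated by simple
    transpositions, under which the codes are closed. *)
Lemma packing_has_code x : exists2 i, i < 240 & represents i x.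
Proof.
have [w xE] : exists w, val x = relabel w (val x0)
  by apply: fano_relabel (valP _) (valP x).
have : w \in <<simple_transpositions>>%g by rewrite gen_simple_transpositions inE.
case/gen_prodgP=> n [c cS wE]; rewrite {}wE in xE.
elim: n c cS x xE => [|n IHn] c cS x xE.
  exists 0 => //; rewrite (_ : x = x0) ?represents_x0 //.
  by apply: val_inj; apply: etrans xE _; rewrite big_ord0 relabel1.
rewrite big_ord_recr relabelM /= in xE.
set w' := (\prod_i _)%g in xE.
pose y := signed_act (unsigned w') x0.
have yE : val y = relabel w' (val x0) by rewrite signed_act_unsigned.
have [i i240 iy] := IHn _ (fun j => cS _) y yE.
have [s s7 cE] := simple_transpositionP (cS ord_max).
have [lt_img _ _] := act_index_codes (ltnW s7) i240.
exists (act_index s i) => //; rewrite (_ : x = signed_act (gen s) y).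
  exact: represents_simple.
by apply: val_inj; apply: etrans xE _; rewrite val_act_simple // yE cE.
Qed.

Definition index_of (x : Omega240) : nat :=
  ex_minn (let: ex_intro2 i i240 ix := packing_has_code x in
           ex_intro (fun i => (i < 240) &&
             represents i x) i (introT andP (conj i240 ix))).

Lemma index_ofP x : index_of x < 240 /\ represents (index_of x) x.
Proof. by rewrite /index_of; case: ex_minnP => i /andP[]. Qed.

(** Descending both indices along the same word reaches x0, whose index is 0. *)
Lemma represents_index i x : i < 240 -> represents i x -> index_of x = i.
Proof.
move=> i240 ix; have [j240 jx] := index_ofP x; move: (index_of x) j240 jx => j.
have [n] := ubnP (height_at i); elim: n i i240 x ix j =>
  // n IHn i i240 x ix j lt_in j240 jx.
have [i0 | i0] := eqVneq i 0.
  rewrite i0 in ix *; apply: code0_unique => // b bj.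
  have : vcoset (bits_set b) \in code_cosets (code 0).
    rewrite -(eqP ix) (eqP jx) in_set.
    exact: (map_f (fun b => vcoset (bits_set b)) bj).
  rewrite in_set => /mapP[c c0 /vcoset_bits_inj ->] //.
    exact: size_code_bits bj.
  exact: size_code_bits c0.
have [s] := height_at_descent (mem_head _ _) i240 i0; rewrite mem_iota => /= s7 lt_s.
have [lt_i imgKi _] := act_index_codes (ltnW s7) i240.
have [lt_j imgKj _] := act_index_codes (ltnW s7) j240.
rewrite -imgKi -imgKj; congr (act_index s _).
apply: (IHn _ lt_i _ (represents_simple s7 i240 ix)) => //.
  exact: leq_trans lt_s lt_in.
exact: represents_simple.
Qed.

Lemma index_of_inj : injective index_of.
Proof.
move=> x y xy; apply: (@represents_inj (index_of x)); first by have [] := index_ofP x.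
by rewrite xy; have [] := index_ofP y.
Qed.

Lemma index_of_x0 : index_of x0 = 0.
Proof. exact: represents_index represents_x0. Qed.

Lemma index_of_gen s x : s < 8 -> index_of (signed_act (gen s) x)
  = act_index s (index_of x).
Proof.
move=> s8; have [i240 ix] := index_ofP x.
have [lt_i _ _] := act_index_codes s8 i240.
exact: represents_index (represents_gen s8 i240 ix).
Qed.

(** * The height of a packing *)

Lemma bigminn_leq (I : finType) (P : pred I) (F : I -> nat) d i :
  P i -> \big[minn/d]_(j | P j) F j <= F i.
Proof.
move=> Pi; elim: (index_enum I) (mem_index_enum i) => // j r IHr.
rewrite inE big_cons => /orP[/eqP<- | /IHr le]; first by rewrite Pi geq_minl.
by case: ifP => // _; rewrite geq_min le orbT.
Qed.

Lemma leq_bigminn (I : finType) (P : pred I) (F : I -> nat) d n :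
  n <= d -> (forall i, P i -> n <= F i) -> n <= \big[minn/d]_(i | P i) F i.
Proof. by move=> nd nF; elim/big_ind: _ => // a b na nb; rewrite leq_min na. Qed.

Definition height (x : Omega240) : nat := height_at (index_of x).

Lemma height_eq0 x : (height x == 0) = (x == x0).
Proof.
apply/eqP/eqP => [hx | ->]; last by rewrite /height index_of_x0; vm_compute.
apply: index_of_inj; rewrite index_of_x0; apply/eqP; apply: contraT => i0.
have [i240 _] := index_ofP x.
by have [s _] := height_at_descent (mem_head _ _) i240 i0; rewrite -/(height x) hx.
Qed.

Lemma height_gen s x : s < 8 ->
  (height (signed_act (gen s) x) <= (height x).+1) &&
  (height x <= (height (signed_act (gen s) x)).+1).
Proof.
by move=> s8; rewrite /height index_of_gen //; apply: height_at_step => //;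
  have [] := index_ofP x.
Qed.

Lemma height_descent gens x : gens \in [:: iota 0 7; 7 :: iota 0 4] -> 0 < height x ->
  exists2 s, s \in gens & height (signed_act (gen s) x) < height x.
Proof.
move=> gensP; rewrite lt0n height_eq0 -(inj_eq index_of_inj) index_of_x0 => i0.
have [i240 _] := index_ofP x; have [s sg lt_s] := height_at_descent gensP i240 i0.
exists s => //; rewrite /height index_of_gen //.
move: gensP sg; rewrite in_cons mem_seq1 => /orP[] /eqP->;
  first by rewrite mem_iota; lia.
by rewrite in_cons mem_iota; lia.
Qed.

(** A simple transposition raises the height by at most 1, so that the height is
    at most the length of any word leading from x0 to x; descents provide a word
    of that length. *)
Lemma height_word n w x : w \in (simple_transpositions ^+ n)%g ->
  val x = relabel w (val x0) -> height x <= n.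
Proof.
elim: n w x => [|n IHn] w x.
  rewrite expg0 => /set1P-> ; rewrite relabel1 => /val_inj->.
  by rewrite leqn0 height_eq0.
rewrite expgSr => /mulsgP[v t vS /simple_transpositionP[s s7 ->] ->].
rewrite relabelM => xE; pose y := signed_act (unsigned v) x0.
have yE : val y = relabel v (val x0) by rewrite signed_act_unsigned.
have -> : x = signed_act (gen s) y.
  by apply: val_inj; apply: etrans xE _; rewrite val_act_simple // yE.
have /andP[le _] := height_gen y (ltnW s7).
by apply: leq_trans le _; rewrite ltnS; apply: IHn yE.
Qed.

Lemma word_to_packing x : exists2 w,
  w \in (simple_transpositions ^+ height x)%g & val x = relabel w (val x0).
Proof.
move: {2}(height x) (erefl (height x)) => n; elim: n x => [|n IHn] x hx.
  exists 1%g; rewrite ?relabel1; first by rewrite hx expg0 set11.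
  by move/eqP: hx; rewrite height_eq0 => /eqP->.
have [|s] := @height_descent (iota 0 7) x (mem_head _ _); first by rewrite hx.
rewrite mem_iota => /= s7 lt_s; have /andP[_ le_s] := height_gen x (ltnW s7).
have hs : height (signed_act (gen s) x) = n by lia.
have [w wS wE] := IHn _ hs.
exists (w * tperm (lab s.+1) (lab s.+2))%g.
  rewrite hx expgSr mem_mulg -?hs //; apply/imsetP.
  by exists (Ordinal s7).
rewrite relabelM -wE val_act_simple // -relabelM tperm2 relabel1 //.
Qed.

(** The lengths considered in the definitions of word_length and ht are bounded
    by the order 8! of S_8. *)
Lemma height_lt_card x : height x < #|{perm 'I_8}|.
Proof.
apply: (@leq_ltn_trans 14); first by apply: height_at_le14; have [] := index_ofP x.
rewrite (card_Sn 8) //.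
Qed.

Lemma htE x : ht x = height x.
Proof.
apply/eqP; rewrite eqn_leq; apply/andP; split.
  have [w wS wE] := word_to_packing x.
  have Pw : relabel w (val x0) == val x by rewrite wE.
  apply: (leq_trans (bigminn_leq (P := fun w => relabel w (val x0) == val x)
    (word_length simple_transpositions) _ Pw)).
  by have := bigminn_leq (fun n : 'I__ => n) #|{perm 'I_8}|
    (wS : (fun n : 'I__ => w \in simple_transpositions ^+ n)%g (Ordinal
      (height_lt_card x))).
apply: leq_bigminn; first exact: ltnW (height_lt_card x).
move=> w /eqP wE; apply: leq_bigminn; first exact: ltnW (height_lt_card x).
by move=> n wn; apply: height_word wn (esym wE).
Qed.

(** * The action of W(D_8) on packings *)

Opaque index_of.
Lemma D_gens8 : D_gens 8 = S_D8.
Proof.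
apply/setP=> t; apply/imsetP/S_D8P => [[s _ ->] | [s s8 ->]]; first by exists s.
exists (Ordinal s8) => //; rewrite inE /=; lia.
Qed.

Lemma gen_S_D8 : <<S_D8>>%g = WD 8.
Proof. by rewrite -D_gens8 gen_D_gens. Qed.

Lemma gen_WD8 s : s < 8 -> gen s \in WD 8.
Proof. by move=> s8; rewrite -gen_S_D8; apply/mem_gen/S_D8P; exists s. Qed.

Lemma lambda_minus_act w x : w \in WD 8 ->
  lambda_minus (signed_act w x) = signed_image w (lambda_minus x).
Proof.
rewrite -gen_S_D8 => /gen_prodgP[n [c cS ->]].
suff [y yE] : exists y, lambda_minus y
  = signed_image (\prod_i c i)%g (lambda_minus x).
  by rewrite (signed_actE yE).
elim: n c cS => [|n IHn] c cS; first by exists x; rewrite big_ord0 signed_image1.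
have [y yE] := IHn _ (fun i => cS (widen_ord (leqnSn n) i)).
have /S_D8P[s s8 cE] := cS ord_max; have [i240 iy] := index_ofP y.
exists (signed_act (gen s) y); rewrite (signed_act_gen s8 i240 iy) yE.
rewrite big_ord_recr cE signed_imageM ?gen_signed //=.
apply: (@WD_signed 8); apply: group_prod => i _.
by have := mem_gen (cS (widen_ord (leqnSn n) i)); rewrite gen_S_D8.
Qed.

Lemma packings_Wset : is_Wset (WD 8) signed_act.
Proof.
split=> [x | v w vW wW x]; apply: signed_actE; first by rewrite signed_image1.
rewrite !lambda_minus_act // signed_imageM ?(WD_signed vW) ?(WD_signed wW) //.
Qed.

Lemma reflection_neighbour r x : r \in reflections <<S_D8>>%g S_D8 ->
  index_of (signed_act r x) \in neighbours (index_of x).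
Proof.
move=> rT; move: r rT x; apply: reflection_ind =>
  [t /S_D8P[s s8 ->] x | r t rT /S_D8P[s s8 ->] IHr x].
  by rewrite index_of_gen //; have [] := act_index_neighbour s8 (index_ofP x).1.
have [_ actM] := packings_Wset; have gW := gen_WD8 s8.
have rW : r \in WD 8 by rewrite -gen_S_D8 reflection_in_gen.
have gV : ((gen s)^-1 = gen s)%g by apply/eqP; rewrite eq_invg_mul gen_involution.
have actK : signed_act (gen s) (signed_act (gen s) x) = x.
  by rewrite -actM // gen_involution // packings_Wset.1.
rewrite conjgE gV !actM ?groupM //.
set y := signed_act (gen s) x.
have [_ closed] := act_index_neighbour s8 (index_ofP y).1.
have := closed _ (IHr y); rewrite -(index_of_gen y s8) actK => moved.
rewrite (index_of_gen _ s8); exact: moved.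
Qed.

(** QP1 and QP2 involve a reflection r only through the pair (x, r x), so it
    suffices that they hold for all neighbours of x. *)
Lemma packings_D8 :
  is_quasiparabolic <<S_D8>>%g S_D8 signed_act (fun x => Posz (ht x)).
Proof.
split.
- split=> [|t /S_D8P[s s8 ->] x]; first by rewrite gen_S_D8; apply: packings_Wset.
  by have := height_gen x s8; rewrite !htE ler_norml; lia.
- move=> r rT x [] /eqP; rewrite !htE /height => hE.
  by have := neighbour_height (index_ofP x).1 (reflection_neighbour x rT); rewrite hE.
move=> r t rT /S_D8P[s s8 ->] x; rewrite !ltz_nat !htE /height !(index_of_gen _ s8)
  => lt1 lt2.
apply: index_of_inj; rewrite (index_of_gen _ s8).
exact: neighbour_exchange s8 (index_ofP x).1 (reflection_neighbour x rT) lt1 lt2.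
Qed.

(** * The Bruhat order as a quasiparabolic order *)

Lemma A_reflectionP r : r \in reflections <<A_gens>>%g A_gens ->
  exists i j, i != j /\ r = unsigned (tperm i j).
Proof.
move: r; apply: reflection_ind => [t | r t _] /imsetP[s _ ->];
  last move=> [i [j [ij ->]]].
  exists (lab s.+1), (lab s.+2); rewrite gen_unsigned //; split=> //.
  by rewrite -val_eqE /= !val_lab //; have := ltn_ord s; lia.
rewrite gen_unsigned //; set u := tperm (lab _) _.
exists (u i), (u j); rewrite (inj_eq perm_inj) -tpermJ; split=> //.
by rewrite [RHS](morphJ unsigned_morphism) ?in_setT.
Qed.

(** S_8 is doubly transitive: w carries the first two labels to i and j. *)
Lemma transposition_reflection i j : i != j ->
  unsigned (tperm i j) \in reflections <<S_D8>>%g S_D8.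
Proof.
move=> ij; pose j' := tperm (lab 1) i j.
pose w := (tperm (lab 2) j' * tperm (lab 1) i)%g.
have j'0 : j' != lab 1.
  by rewrite -(inj_eq (@perm_inj _ (tperm (lab 1) i))) tpermK tpermL eq_sym.
have l12 : lab 2 != lab 1 by rewrite -val_eqE /= !val_lab.
have wE : tperm i j = (tperm (lab 1) (lab 2) ^ w)%g.
  by rewrite tpermJ /w !permM tpermL (tpermD l12 j'0) tpermL /j' tpermK.
rewrite wE [unsigned _](morphJ unsigned_morphism) ?inE //.
apply: imset2_f; first by apply/S_D8P; exists 0; rewrite ?gen_unsigned.
have /subsetP : unsigned_S8 \subset <<S_D8>>%g.
  rewrite -gen_A_gens; apply: genS; apply/subsetP=> _ /imsetP[s _ ->].
  by apply/S_D8P; exists s; rewrite // ltnW // ltnS.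
by apply; rewrite unsigned_S8E imset_f.
Qed.

Lemma bruhat_le_height x y : bruhat_le x y -> x = y \/ ht x < ht y.
Proof.
case/connectP=> p; elim: p x => [|z p IHp] x /=; first by move=> _ ->; left.
case/andP=> /existsP[i /existsP[j /and3P[_ _ lt_xz]]] zp yE; right.
by have [<- | ] := IHp z zp yE; [ | apply: ltn_trans].
Qed.

Lemma bruhat_partial_order : is_partial_order (fun x y => bruhat_le x y).
Proof.
split=> [x | x y xy yx | x y z]; [exact: connect0 | | exact: connect_trans].
case: (bruhat_le_height xy) => // lt_xy; case: (bruhat_le_height yx) => // lt_yx.
by have := ltn_trans lt_xy lt_yx; rewrite ltnn.
Qed.

(** The two families of generators among which every packing other than x0 has a
    descent: those of S_8 and those of W(D_5). *)
Section Parabolic.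

Variable gens : seq nat.
Hypothesis gensP : gens \in [:: iota 0 7; 7 :: iota 0 4].

Let J : {set {perm signed_obj}} := [set gen s | s : 'I_8 & val s \in gens].

Lemma low_gens_sub : J \subset S_D8.
Proof. by apply/subsetP=> _ /imsetP[s _ ->]; apply/S_D8P; exists s. Qed.

Lemma low_gens_descent x :
  0 < ht x -> exists2 t, t \in J & ht (signed_act t x) < ht x.
Proof.
rewrite htE => /(height_descent gensP)[s sg lt_s]; exists (gen s);
  last by rewrite !htE.
have s8 : s < 8.
  move: gensP sg; rewrite in_cons mem_seq1 => /orP[] /eqP->;
    first by rewrite mem_iota; lia.
  by rewrite in_cons mem_iota; lia.
by apply/imsetP; exists (Ordinal s8); rewrite ?inE.
Qed.

Lemma S_D8_involution : {in S_D8, forall t, (t * t = 1)%g}.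
Proof. by move=> _ /S_D8P[s s8 ->]; apply: gen_involution. Qed.

Lemma increases_low_gens (R : Omega240 -> Omega240 -> Prop) : is_partial_order R ->
  increases_under_reflections <<J>>%g J signed_act (fun x => Posz (ht x)) R ->
  increases_under_reflections <<S_D8>>%g S_D8 signed_act (fun x => Posz (ht x)) R.
Proof.
exact: (increases_under_parabolic packings_D8 S_D8_involution low_gens_sub
  low_gens_descent).
Qed.

Lemma low_gens_transitive (I : {set {perm signed_obj}}) :
  I \subset S_D8 -> J \subset I -> is_transitive <<I>>%g signed_act.
Proof.
move=> sIS sJI x y; have [_ actM] := packings_Wset.
have /subsetP gIW : <<I>>%g \subset WD 8 by rewrite -gen_S_D8 genS.
have from_x0 z : exists2 w, w \in <<I>>%g & signed_act w x0 = z.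
  have [n] := ubnP (ht z); elim: n z => // n IHn z lt_zn.
  have [z0 | z0] := posnP (ht z).
    exists 1%g; rewrite ?group1 // packings_Wset.1.
    by apply/esym/eqP; rewrite -height_eq0 -htE z0.
  have [t tJ lt_t] := low_gens_descent z0.
  have [w wI wE] := IHn _ (leq_trans lt_t lt_zn).
  have tI : t \in <<I>>%g by apply/mem_gen/(subsetP sJI).
  exists (w * t)%g; rewrite ?groupM // actM ?gIW // wE -actM ?gIW //.
  by rewrite S_D8_involution ?packings_Wset.1 // (subsetP low_gens_sub).
have [v vI <-] := from_x0 x; have [w wI <-] := from_x0 y.
exists (v^-1 * w)%g; first by rewrite groupM ?groupV.
by rewrite -actM ?gIW ?groupM ?groupV // mulKVg.
Qed.

End Parabolic.

(** The reflections of S_8 are the transpositions, so the Bruhat order increases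
    under them by definition, and thus under all reflections of W(D_8). *)
Lemma bruhat_increases :
  increases_under_reflections <<S_D8>>%g S_D8 signed_act (fun x => Posz (ht x))
    (fun x y => bruhat_le x y).
Proof.
apply: (@increases_low_gens (iota 0 7)) bruhat_partial_order _; first exact: mem_head.
have -> : [set gen s | s : 'I_8 & val s \in iota 0 7] = A_gens.
  apply/setP=> t; apply/imsetP/imsetP => [[s + ->] | [s _ ->]].
    by rewrite inE mem_iota => /andP[_ s7]; exists (Ordinal s7).
  exists (widen_ord (leqnSn 7) s) => //.
  by rewrite inE mem_iota /= ltn_ord.
move=> r rA x; rewrite lez_nat leq_eqVlt => /orP[/eqP hE | lt_x].
  have rT : r \in reflections <<S_D8>>%g S_D8.
    have [i [j [ij ->]]] := A_reflectionP rA; exact: transposition_reflection.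
  have [_ qp1 _] := packings_D8; have -> : signed_act r x = x by apply: qp1 => //;
    rewrite hE.
  exact: connect0.
have [i [j [ij rE]]] := A_reflectionP rA; apply: connect1.
apply/existsP; exists i; apply/existsP; exists j.
by rewrite ij lt_x andbT rE /= -signed_act_unsigned.
Qed.

Lemma bruhat_least (R : Omega240 -> Omega240 -> Prop) : is_partial_order R ->
  increases_under_reflections <<S_D8>>%g S_D8 signed_act (fun x => Posz (ht x)) R ->
  forall x y, bruhat_le x y -> R x y.
Proof.
case=> [Rrefl _ Rtrans] Rinc x y /connectP[p]; elim: p x => [|z p IHp] x /=;
  first by move=> _ ->.
case/andP=> /existsP[i /existsP[j /and3P[ij /eqP zE lt_xz]]] zp /(IHp z zp).
apply: Rtrans; have -> : z = signed_act (unsigned (tperm i j)) x.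
  by apply: val_inj; rewrite signed_act_unsigned.
apply: Rinc; first exact: transposition_reflection.
have <- : z = signed_act (unsigned (tperm i j)) x.
  by apply: val_inj; rewrite signed_act_unsigned.
by rewrite lez_nat ltnW.
Qed.

(** The axioms pass from W(D_8) to <<I>>. An order increasing under the
    reflections of <<I>> increases under those of W(D_8) as soon as I contains
    one of the two families, hence contains the Bruhat order. *)
Lemma packings_parabolic gens (I : {set {perm signed_obj}}) :
  gens \in [:: iota 0 7; 7 :: iota 0 4] -> I \subset S_D8 ->
  (forall s, s \in gens -> gen s \in I) ->
  packings_quasiparabolic <<I>>%g I /\ quasiparabolic_order_is_bruhat <<I>>%g I.
Proof.
move=> gensP sIS gensI.
have sJI : [set gen s | s : 'I_8 & val s \in gens] \subset I.
  by apply/subsetP=> _ /imsetP[s + ->]; rewrite inE; apply: gensI.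
split; first split=> //.
- exact: sub_quasiparabolic packings_D8.
- exact: low_gens_transitive sJI.
- move=> s _; have /eqP-> : ht x0 == 0 by rewrite htE height_eq0.
  by rewrite lez_nat.
split; first exact: bruhat_partial_order.
  move=> r /(subsetP (sub_reflections sIS)); exact: bruhat_increases.
move=> R Rpo Rinc; apply: bruhat_least => //;
  apply: (increases_low_gens gensP) => // r rJ.
by apply: Rinc; apply: subsetP rJ; apply: sub_reflections.
Qed.

(** * The sets of generators *)

Lemma gen_eq s t : s < 8 -> t < 8 -> (gen s == gen t) = (s == t).
Proof. by move=> s8 t8; apply/eqP/eqP => [/gen_inj-> | ->]. Qed.

Lemma S_D8_setD n (B : {set {perm signed_obj}}) :
  (forall s, s < 8 -> (gen s \in B) = (n <= s.+1) && (s != 7)) ->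
    S_D8 :\: B = D_gens n.
Proof.
move=> memB; apply/setP=> t; rewrite inE.
apply/andP/imsetP => [[tB /S_D8P[s s8 tE]] | [s + ->]].
  exists (Ordinal s8) => //; move: tB; rewrite tE memB // inE /=; lia.
by rewrite inE memB // => sn; split; [lia | apply/S_D8P; exists s].
Qed.

Lemma S_D8_setD1 : S_D8 :\ swap_bar 1 2 = A_gens.
Proof.
apply/setP=> t; rewrite in_setD1 -[swap_bar 1 2]/(gen 7).
apply/andP/imsetP => [[t7 /S_D8P[s s8 tE]] | [s _ ->]].
  have s7 : s < 7 by move: t7; rewrite tE gen_eq //; lia.
  by exists (Ordinal s7).
have s8 : s < 8 by rewrite ltnW // ltnS.
by rewrite gen_eq // ltn_eqF //; split=> //; apply/S_D8P; exists s.
Qed.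

Lemma gen_invariant (gT : finType) (I : {set {perm gT}}) (Y : pred gT) :
  {in I, forall (t : {perm gT}) p, Y p -> Y (t p)} ->
  {in <<I>>%g, forall (t : {perm gT}) p, Y p -> Y (t p)}.
Proof.
move=> IY _ /gen_prodgP[n [c cI ->]] p Yp.
elim: n c cI => [|n IHn] c cI; first by rewrite big_ord0 perm1.
by rewrite big_ord_recr permM; apply: IY => //; apply: IHn.
Qed.

(** Each generator gen s of W(D_5) moves out of itself a set Y of signed objects
    that all other generators of W(D_8) preserve: the positive objects if gen s
    is the signed exchange; if s = 0 these objects with the first one replaced
    by its negative; and otherwise the objects of absolute value at most s. *)
Lemma D5_gens_necessary (I : {set {perm signed_obj}}) s :
  I \subset S_D8 -> WD 5 \subset <<I>>%g -> s \in 7 :: iota 0 4 -> gen s \in I.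
Proof.
move=> sIS sDI; rewrite in_cons mem_iota /= => sP.
have s8 : s < 8 by lia.
apply: contraT => sI.
pose Y := [pred p : signed_obj |
  if s == 7 then ~~ p.2 else if s == 0 then p.2 == (p.1 == 0 :> nat) else p.1 <= s].
have YI : {in I, forall (t : {perm signed_obj}) p, Y p -> Y (t p)}.
  move=> t tI [k b]; have /S_D8P[u u8 tE] := subsetP sIS t tI.
  have us : u != s by apply: contraNneq sI => <-; rewrite -tE.
  rewrite tE genP //= inordK; last by rewrite ltn_adj // ltn_mod.
  have [u7 | u7] := eqVneq u 7.
    rewrite u7 modnn in us *; rewrite eq_sym (negPf us) /adj.
    by case: b; case: (k : nat) => [|[|m]] //=; case: ifP => //; lia.
  rewrite modn_small; last by lia.
  rewrite addbF; case: ifP => // _; case: ifP => [/eqP s0 | _];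
    last by rewrite /adj; do 2?case: eqP; lia.
  suff -> : (adj u k == 0) = (k == 0 :> nat) by [].
  by rewrite /adj; case: (eqVneq (k : nat) u) => ?;
    [|case: (eqVneq (k : nat) u.+1) => ?]; lia.
have gs : gen s \in <<I>>%g.
  apply: (subsetP sDI); apply: (subsetP (D_gens_sub (isT : 1 < 5))).
  by apply/mem_gen/mem_D_gens; lia.
have {YI gs} Ys := gen_invariant YI gs.
pose p : signed_obj := (inord (if s == 7 then 0 else s), s == 0).
have := Ys p; rewrite /p genP // /Y /= !inordK;
  try (by rewrite ?ltn_adj ?inordK // ?ltn_mod //; case: ifP; lia).
have : s = 7 \/ s = 0 \/ s = 1 \/ s = 2 \/ s = 3 by lia.
case=> [-> | [-> | [-> | [-> | ->]]]]; by move=> /(_ isT).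
Qed.

Theorem theorem4p8 :
  (* (i) *)
  ((forall w x, w \in WD 8 ->
      lambda_minus (signed_act w x) = signed_image w (lambda_minus x))
   /\ packings_quasiparabolic (WD 8) S_D8)
  /\
  (* (ii) (a) *)
  (packings_quasiparabolic unsigned_S8 (S_D8 :\ swap_bar 1 2)
   /\ quasiparabolic_order_is_bruhat unsigned_S8 (S_D8 :\ swap_bar 1 2))
  /\
  (* (ii) (b) *)
  (packings_quasiparabolic (WD 5) (S_D8 :\: [set swap 5 6; swap 6 7; swap 7 8])
   /\ quasiparabolic_order_is_bruhat
        (WD 5) (S_D8 :\: [set swap 5 6; swap 6 7; swap 7 8]))
  /\
  (* (ii) (c) *)
  (forall I : {set {perm signed_obj}},
     I \subset S_D8 -> WD 5 \subset <<I>>%g -> <<I>>%g \subset WD 8 ->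
     packings_quasiparabolic <<I>>%g I
     /\ quasiparabolic_order_is_bruhat <<I>>%g I)
  /\
  (packings_quasiparabolic (WD 6) (S_D8 :\: [set swap 6 7; swap 7 8])
   /\ quasiparabolic_order_is_bruhat (WD 6) (S_D8 :\: [set swap 6 7; swap 7 8]))
  /\
  (packings_quasiparabolic (WD 7) (S_D8 :\ swap 7 8)
   /\ quasiparabolic_order_is_bruhat (WD 7) (S_D8 :\ swap 7 8)).
Proof.
have D_case n : 4 < n <= 8 ->
    packings_quasiparabolic (WD n) (D_gens n)
    /\ quasiparabolic_order_is_bruhat (WD n) (D_gens n).
  move=> n58; rewrite -gen_D_gens; last by lia.
  apply: (@packings_parabolic (7 :: iota 0 4)); first by rewrite !in_cons eqxx orbT.
    by apply/subsetP=> _ /imsetP[s _ ->]; apply/S_D8P; exists s.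
  by move=> s; rewrite in_cons mem_iota => sP; apply: mem_D_gens; lia.
have D5 : S_D8 :\: [set swap 5 6; swap 6 7; swap 7 8] = D_gens 5.
  apply: S_D8_setD => s s8; rewrite !inE -[swap 5 6]/(gen 4) -[swap 6 7]/(gen 5).
  by rewrite -[swap 7 8]/(gen 6) !gen_eq //; lia.
have D6 : S_D8 :\: [set swap 6 7; swap 7 8] = D_gens 6.
  apply: S_D8_setD => s s8; rewrite !inE -[swap 6 7]/(gen 5) -[swap 7 8]/(gen 6).
  by rewrite !gen_eq //; lia.
have D7 : S_D8 :\ swap 7 8 = D_gens 7.
  apply: S_D8_setD => s s8; rewrite !inE -[swap 7 8]/(gen 6) !gen_eq //; lia.
rewrite D5 D6 D7 S_D8_setD1; split; last split; last split; last split; last split.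
- split; first exact: lambda_minus_act.
  by rewrite -D_gens8; have [] := D_case 8 isT.
- rewrite -gen_A_gens; apply: (@packings_parabolic (iota 0 7)); first exact: mem_head.
    by rewrite -S_D8_setD1 subsetDl.
  move=> s; rewrite mem_iota => /andP[_ s7]; by apply/imsetP; exists (Ordinal s7).
- exact: D_case.
- move=> I sIS sDI _; apply: (@packings_parabolic (7 :: iota 0 4)) => // s.
  exact: D5_gens_necessary.
- exact: D_case.
exact: D_case.
Qed.
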